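(* Fix $n$. There is a single algorithm such that for every forest $A\subset\mathbb{R}^n$ the following holds for all but countably many $r\in(\min_{\lambda\ge0}\mathrm{esc}(A,\partial A,\lambda),\infty)$: given the signed distance function of $A_r=\{x\in\mathbb{R}^n:\mathrm{dist}^+(A,\partial A,x)\le r\}$ as an oracle, the algorithm computes in the limit a solution of the forest problem for $A_r$, i.e. a path $f$ of length $L_1(A_r)$ with $\mathrm{wcc}(A_r,\partial A_r,[f])=0$.
   Context: A forest in $\mathbb{R}^n$ is a (nonempty) compact subset $A\subset\mathbb{R}^n$. For $L\ge 0$, $P^L$ is the set of paths of length $\le L$, i.e. of equivalence classes $[f]$ of $L$-Lipschitz maps $f:[0,1]\to\mathbb{R}^n$ up to reparameterization, rotation and translation. Signed distance: $\mathrm{dist}^+(A,\partial A,x)=\mathrm{dist}(x,\partial A)$ if $x\notin A$, and $=-\mathrm{dist}(x,\partial A)$ if $x\in A$. With $\mathrm{Isom}^+(\mathbb{R}^n)$ the group of orientation preserving isometries, $$\mathrm{con}(A,\partial A,f)=\max_{t\in[0,1]}\mathrm{dist}^+(A,\partial A,f(t)),\quad \mathrm{wcc}(A,\partial A,[f])=\min_{\sigma\in\mathrm{Isom}^+(\mathbb{R}^n)}\mathrm{con}(A,\partial A,\sigma\circ f),$$ $$\mathrm{esc}(A,\partial A,L)=\max_{[f]\in P^L}\mathrm{wcc}(A,\partial A,[f]).$$ $L_1(A)=\sup\{\lambda\ge 0:\mathrm{esc}(A,\partial A,\lambda)<0\}$. A path escapes $A$ if in every placement (rotation and translation) it meets the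 boundary or exterior of $A$; the forest problem for $A$ asks for a path of minimal length which escapes $A$, equivalently for the minimal $L$ with $\mathrm{esc}(A,\partial A,L)=0$ and a witnessing path of that length. A forest is presented by its signed distance function, as an oracle returning rational approximations of any prescribed accuracy at rational points. A path is specified by a name of a representative Lipschitz map (rational approximations to within $2^{-k}$ for every $k$); to compute it in the limit means to produce, computably from the oracle, successive guesses for each entry of such a name, each entry's guesses being eventually constant and equal to the correct value. *)

(* Defs.v *)
From Stdlib Require Cantor.
From mathcomp Require Import all_boot all_order all_algebra.
From mathcomp Require Import all_classical all_reals all_analysis.

Set Implicit Arguments.
Unset Strict Implicit.
Unset Printing Implicit Defensive.

Import Order.TTheory GRing.Theory Num.Theory.
Import numFieldNormedType.Exports.

Local Open Scope classical_set_scope.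
Local Open Scope ring_scope.

Section Forests.
Variables (R : realType) (n : nat).
Implicit Types (A B : set 'rV[R]_n) (f : R -> 'rV[R]_n) (x : 'rV[R]_n).

(* The norm of the library on ['rV_n] is the sup norm; it induces the same
   topology, but distances and isometries here are Euclidean. *)
Definition enorm x : R := Num.sqrt (\sum_(i < n) x 0 i ^+ 2).

Definition forest A : Prop := A !=set0 /\ compact A.

Definition boundary A : set 'rV[R]_n := closure A `\` interior A.

Definition dist x B : R := inf [set enorm (x - y) | y in B].

Definition sdist A x : R :=
  if x \in A then - dist x (boundary A) else dist x (boundary A).

Definition isom_plus (sigma : 'rV[R]_n -> 'rV[R]_n) : Prop :=
  (forall x y, enorm (sigma x - sigma y) = enorm (x - y)) /\
  exists (M : 'M[R]_n) (v : 'rV[R]_n),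
    0 < \det M /\ forall x, sigma x = x *m M + v.

(* A path in [P^L] is handled through a representative [f]; only the values of
   [f] on [[0, 1]] matter. *)
Definition paths (L : R) : set (R -> 'rV[R]_n) :=
  [set f | forall s t : R, 0 <= s <= 1 -> 0 <= t <= 1 ->
     enorm (f s - f t) <= L * `|s - t|].

Definition polygon_length f (s : seq R) : R :=
  \sum_(i < size s) enorm (f (nth 0 s i) - f (nth 0 (0 :: s) i)).

(* The length of the curve [f] on [[0, 1]]: the partitions of [itv_partition]
   omit the initial point [0]. *)
Definition arc_length f : R :=
  sup [set polygon_length f s | s in itv_partition 0 1].

(* For forests in dimension [n > 0] and Lipschitz paths, the suprema and infima
   below are taken over nonempty sets, and are attained in [con], [wcc], [esc]
   and [min_esc]. *)
Definition con A f : R := sup [set sdist A (f t) | t in `[0, 1]].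

Definition wcc A f : R := inf [set con A (sigma \o f) | sigma in isom_plus].

Definition esc A (L : R) : R := sup [set wcc A f | f in paths L].

Definition min_esc A : R := inf [set esc A l | l in [set l : R | 0 <= l]].

Definition L1 A : R := sup [set l : R | 0 <= l /\ esc A l < 0].

Definition sublevel A (r : R) : set 'rV[R]_n := [set x | sdist A x <= r].

Definition forest_solution A f : Prop :=
  [/\ paths (L1 A) f, arc_length f = L1 A & wcc A f = 0].

End Forests.

Definition pair_nat (a b : nat) : nat := Cantor.to_nat (a, b).
Definition fst_nat (m : nat) : nat := (Cantor.of_nat m).1.
Definition snd_nat (m : nat) : nat := (Cantor.of_nat m).2.

Inductive program : Type :=
| Zero | Succ | Fst | Snd
| Oracle
| Pair of program & program
| Comp of program & program
| Prec of program & program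
| Mu of program.

(* [eval o c x y]: with oracle [o], program [c] halts on input [x] with
   output [y]. *)
Inductive eval (o : nat -> nat) : program -> nat -> nat -> Prop :=
| eval_zero x : eval o Zero x 0
| eval_succ x : eval o Succ x x.+1
| eval_fst x : eval o Fst x (fst_nat x)
| eval_snd x : eval o Snd x (snd_nat x)
| eval_oracle x : eval o Oracle x (o x)
| eval_pair c d x a b :
    eval o c x a -> eval o d x b -> eval o (Pair c d) x (pair_nat a b)
| eval_comp c d x y z :
    eval o d x y -> eval o c y z -> eval o (Comp c d) x z
| eval_prec0 c d x y :
    eval o c x y -> eval o (Prec c d) (pair_nat x 0) y
| eval_precS c d x m y z :
    eval o (Prec c d) (pair_nat x m) y ->
    eval o d (pair_nat x (pair_nat m y)) z ->
    eval o (Prec c d) (pair_nat x m.+1) z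
| eval_mu c x m (w : nat -> nat) :
    (forall i, (i < m)%N -> eval o c (pair_nat x i) (w i).+1) ->
    eval o c (pair_nat x m) 0 -> eval o (Mu c) x m.

Definition nat_of_int (z : int) : nat :=
  match z with Posz a => a.*2 | Negz a => a.*2.+1 end.

Definition int_of_nat (m : nat) : int :=
  if odd m then Negz m./2 else Posz m./2.

Definition nat_of_rat (q : rat) : nat :=
  pair_nat (nat_of_int (numq q)) (absz (denq q)).-1.

Definition rat_of_nat (m : nat) : rat :=
  (int_of_nat (fst_nat m))%:~R / (snd_nat m).+1%:R.

(* [m] is read as [<a_0, <a_1, ... <a_(n-1), _> ...>>], where [a_i] denotes the
   [i]-th coordinate. *)
Definition vec_of_nat (n : nat) (m : nat) : 'rV[rat]_n :=
  \row_(i < n) rat_of_nat (fst_nat (iter i snd_nat m)).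

Lemma int_of_natK z : int_of_nat (nat_of_int z) = z.
Proof.
case: z => a; rewrite /int_of_nat /= odd_double ?doubleK //=.
by rewrite uphalf_double.
Qed.

Lemma rat_of_natK q : rat_of_nat (nat_of_rat q) = q.
Proof.
rewrite /rat_of_nat /nat_of_rat /fst_nat /snd_nat /pair_nat.
rewrite Cantor.cancel_of_to /= int_of_natK prednK ?absz_gt0 ?denq_neq0 //.
by rewrite -[_%:R]/((Posz `|denq q|)%:~R) absz_denq divq_num_den.
Qed.

Lemma vec_of_nat_surj n (v : 'rV[rat]_n) : exists m, vec_of_nat n m = v.
Proof.
have ex_code k (a : nat -> rat) : exists m, forall i, (i < k)%N ->
    rat_of_nat (fst_nat (iter i snd_nat m)) = a i.
  elim: k a => [|k IHk] a; first by exists 0%N.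
  have [m Hm] := IHk (fun i => a i.+1).
  exists (pair_nat (nat_of_rat (a 0%N)) m) => -[|i] lt_i.
    by rewrite /= /fst_nat Cantor.cancel_of_to /= rat_of_natK.
  have tailE : snd_nat (pair_nat (nat_of_rat (a 0%N)) m) = m.
    by rewrite /snd_nat Cantor.cancel_of_to.
  by rewrite iterSr tailE Hm.
have [m Hm] := ex_code n (fun i => if insub i is Some j then v 0 j else 0).
exists m; apply/rowP => i; rewrite mxE Hm // insubT //=.
by move=> lt_i; congr (v 0 _); apply: val_inj.
Qed.

Section Computation.
Variables (R : realType) (n : nat).
Implicit Types (A : set 'rV[R]_n) (f : R -> 'rV[R]_n).

Definition vec_of_rat (q : 'rV[rat]_n) : 'rV[R]_n := map_mx ratr q.

Definition sdist_name A (phi : 'rV[rat]_n -> nat -> rat) : Prop :=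
  forall (q : 'rV[rat]_n) (k : nat),
    `|ratr (phi q k) - sdist A (vec_of_rat q)| <= 2^-1 ^+ k.

Definition oracle_of (phi : 'rV[rat]_n -> nat -> rat) (m : nat) : nat :=
  nat_of_rat (phi (vec_of_nat n (fst_nat m)) (snd_nat m)).

Definition path_name f (nu : rat -> nat -> 'rV[rat]_n) : Prop :=
  forall (t : rat) (k : nat), 0 <= t <= 1 ->
    enorm (vec_of_rat (nu t k) - f (ratr t)) <= 2^-1 ^+ k.

(* On input [<<t, k>, s>] the program [c] halts with its [s]-th guess for the
   entry of index [(t, k)] of the name [nu]. *)
Definition limit_computes (c : program) (o : nat -> nat)
    (nu : rat -> nat -> 'rV[rat]_n) : Prop :=
  forall (t : rat) (k : nat), 0 <= t <= 1 ->
    exists guess : nat -> nat,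
      (forall s, eval o c (pair_nat (pair_nat (nat_of_rat t) k) s) (guess s)) /\
      exists s0, forall s, (s0 <= s)%N -> vec_of_nat n (guess s) = nu t k.

Definition limit_solves (c : program) A : Prop :=
  forall phi, sdist_name A phi ->
    exists f nu, [/\ forest_solution A f, path_name f nu &
                     limit_computes c (oracle_of phi) nu].

End Computation.

(* Main.v *)
(* Write [B = A_r]. The function [esc A] is nondecreasing, so if [r] is not one
   of its countably many values at rational lengths, then [esc A q < r] for
   rational [q < L1 B] and [esc A q > r] for rational [q > L1 B]; as the signed
   distance is 1-Lipschitz, [esc B q] is then negative, resp. positive, at these
   [q]. Hence "longer than [L1 B]" can be detected in finite time: by compactness
   of the relevant placements, a path [g] with [wcc B g > 0] can be certified.
   The solutions are thus the paths from 0 that are never refuted, where [f] is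
   refuted by a placement inside the interior of [B], or by a certified path with
   a smaller Lipschitz constant. At stage [s] one tests all rational polygons with
   [4 ^ s] edges up to a precision [2 ^ - s], using only finitely many placements;
   all estimates hold for [s] large enough, which is all that a computation in
   the limit needs. The name is found entry by entry: the guess for the next
   entry is the least code that, with the previous guesses, is compatible with
   some polygon that passes the test; it stabilizes because the solutions form a
   compact set. The placements are products of Householder reflections in
   rational vectors, which are exact isometries and are dense by the theorem of
   Cartan and Dieudonne. *)
Require Import Defs.
From Stdlib Require Cantor.
From mathcomp Require Import all_boot all_order all_algebra.
From mathcomp Require Import all_classical all_reals all_analysis.
From mathcomp Require Import zify ring lra.

Set Implicit Arguments.
Unset Strict Implicit.
Unset Printing Implicit Defensive.

Import Order.TTheory GRing.Theory Num.Theory.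
Import numFieldNormedType.Exports.
(* [all_analysis] shadows some names of [Defs]. *)
Import Defs.

Local Open Scope nat_scope.

(** * Computable functions *)

(** The obstacle is that the oracle decides no comparison of reals: at no stage is it known whether
    a polygon escapes, what [L1 B] is, or how large the stage has to be. Every test therefore
    carries a slack that vanishes with the stage, and its correctness is a pair of asymptotic
    statements: the discretization of a solution passes at all large stages ([candidate_complete],
    [consistent_complete]), and polygons that pass at infinitely many stages cluster at a solution
    ([consistent_sound]). This pair is what makes a least guess settle: a wrong code is accepted
    only finitely often, a right one rejected only finitely often. Solutions need not be unique; the
    guesses select one. All that is used of the generic value [r] is collected in [sharp], a margin
    on either side of the critical length. The unknown constants ([L], the size of the forest, the
    margins) enter only through conditions [c <= 2 ^ s], which hold eventually. *)

Lemma pair_natK m : pair_nat (fst_nat m) (snd_nat m) = m.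
Proof.
by rewrite /pair_nat /fst_nat /snd_nat -surjective_pairing Cantor.cancel_to_of.
Qed.

Lemma fst_pair_nat a b : fst_nat (pair_nat a b) = a.
Proof. by rewrite /fst_nat /pair_nat Cantor.cancel_of_to. Qed.

Lemma snd_pair_nat a b : snd_nat (pair_nat a b) = b.
Proof. by rewrite /snd_nat /pair_nat Cantor.cancel_of_to. Qed.

(** Monotonicity turns a bound on the entries of a list into a bound on its code, so that a search
    over all codes up to that bound meets every such list. *)
Lemma leq_pair_nat a a' b b' :
  a <= a' -> b <= b' -> pair_nat a b <= pair_nat a' b'.
Proof.
move=> aa' bb'; rewrite /pair_nat.
by have := Cantor.to_nat_spec a b; have := Cantor.to_nat_spec a' b'; nia.
Qed.

(** One program serves all oracles; this uniformity is what allows the program of the theorem to be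
    chosen before the forest. *)
Definition computable (F : (nat -> nat) -> nat -> nat) : Prop :=
  exists c, forall o x, eval o c x (F o x).

Definition computable2 (F : (nat -> nat) -> nat -> nat -> nat) : Prop :=
  computable (fun o z => F o (fst_nat z) (snd_nat z)).

Definition computable3 (F : (nat -> nat) -> nat -> nat -> nat -> nat) : Prop :=
  computable
    (fun o z => F o (fst_nat z) (fst_nat (snd_nat z)) (snd_nat (snd_nat z))).

Definition computable4 (F : (nat -> nat) -> nat -> nat -> nat -> nat -> nat) : Prop :=
  computable3 (fun o x y z => F o x y (fst_nat z) (snd_nat z)).

Section Computable.
Implicit Types F G : (nat -> nat) -> nat -> nat.

Lemma eq_computable F G : (forall o x, F o x = G o x) -> computable F -> computable G.
Proof. by move=> FG [c cP]; exists c => o x; rewrite -FG. Qed.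

Lemma computable_comp F G :
  computable F -> computable G -> computable (fun o x => F o (G o x)).
Proof. by move=> [c cP] [d dP]; exists (Comp c d) => o x; exact: eval_comp. Qed.

Lemma computable_id : computable (fun _ x => x).
Proof.
exists (Pair Fst Snd) => o x; rewrite -[X in eval _ _ _ X]pair_natK.
by apply: eval_pair; constructor.
Qed.

Lemma computable_fst F : computable F -> computable (fun o x => fst_nat (F o x)).
Proof.
by move=> cF; apply: (@computable_comp (fun _ => fst_nat)) => //; exists Fst; constructor.
Qed.

Lemma computable_snd F : computable F -> computable (fun o x => snd_nat (F o x)).
Proof.
by move=> cF; apply: (@computable_comp (fun _ => snd_nat)) => //; exists Snd; constructor.
Qed.

Lemma computable_oracle F : computable F -> computable (fun o x => o (F o x)).
Proof.
by move=> cF; apply: (@computable_comp id) => //; exists Oracle; constructor.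
Qed.

Lemma computable_succ F : computable F -> computable (fun o x => (F o x).+1).
Proof.
by move=> cF; apply: (@computable_comp (fun _ => succn)) => //; exists Succ; constructor.
Qed.

Lemma computable_const k : computable (fun _ _ => k).
Proof.
elim: k => [|k IHk]; first by exists Zero; constructor.
exact: computable_succ.
Qed.

Lemma computable_pair F G :
  computable F -> computable G -> computable (fun o x => pair_nat (F o x) (G o x)).
Proof. by move=> [c cP] [d dP]; exists (Pair c d) => o x; exact: eval_pair. Qed.

Lemma computable2_app H F G : computable2 H -> computable F -> computable G ->
  computable (fun o x => H o (F o x) (G o x)).
Proof.
move=> cH cF cG; have := computable_comp cH (computable_pair cF cG).
by apply: eq_computable => o x; rewrite fst_pair_nat snd_pair_nat.
Qed.

Lemma computable3_app H F G K :
  computable3 H -> computable F -> computable G -> computable K ->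
  computable (fun o x => H o (F o x) (G o x) (K o x)).
Proof.
move=> cH cF cG cK.
have := computable_comp cH (computable_pair cF (computable_pair cG cK)).
by apply: eq_computable => o x; rewrite !(fst_pair_nat, snd_pair_nat).
Qed.

Lemma computable4_app H F G K L :
  computable4 H -> computable F -> computable G -> computable K -> computable L ->
  computable (fun o x => H o (F o x) (G o x) (K o x) (L o x)).
Proof.
move=> cH cF cG cK cL.
have := computable_comp cH (computable_pair cF (computable_pair cG (computable_pair cK cL))).
by apply: eq_computable => o x; rewrite !(fst_pair_nat, snd_pair_nat).
Qed.

Fixpoint primrec (F : nat -> nat -> nat) (y m : nat) : nat :=
  if m is m'.+1 then F m' (primrec F y m') else y.

Lemma computable_primrec H F G :
  computable3 H -> computable F -> computable G ->
  computable (fun o x => primrec (H o x) (F o x) (G o x)).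
Proof.
move=> [h hP] [f fP] [g gP].
exists (Comp (Prec f h) (Pair (Pair Fst Snd) g)) => o x.
have idP : eval o (Pair Fst Snd) x x.
  by rewrite -[X in eval _ _ _ X]pair_natK; apply: eval_pair; constructor.
apply: (@eval_comp _ _ _ _ (pair_nat x (G o x))); first exact: eval_pair.
elim: (G o x) => [|m IHm] /=; first exact: eval_prec0.
apply: eval_precS IHm _.
by have := hP o (pair_nat x (pair_nat m (primrec (H o x) (F o x) m)));
   rewrite !(fst_pair_nat, snd_pair_nat).
Qed.

Lemma computable_iter H F G :
  computable2 H -> computable F -> computable G ->
  computable (fun o x => iter (G o x) (H o x) (F o x)).
Proof.
move=> cH cF cG.
have : computable3 (fun o x _ y => H o x y).
  apply: (computable2_app cH).
    exact: (computable_fst computable_id).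
  exact: (computable_snd (computable_snd computable_id)).
move=> /computable_primrec /(_ cF cG); apply: eq_computable => o x.
by elim: (G o x) => //= m ->.
Qed.

Lemma computable_addn F G :
  computable F -> computable G -> computable (fun o x => F o x + G o x).
Proof.
move=> cF cG; have : computable2 (fun _ _ y => y.+1).
  exact: (computable_succ (computable_snd computable_id)).
move=> /computable_iter /(_ cF cG); apply: eq_computable => o x.
by elim: (G o x) => [|m /= ->]; rewrite ?addn0 ?addnS.
Qed.

Lemma computable_muln F G :
  computable F -> computable G -> computable (fun o x => F o x * G o x).
Proof.
move=> cF cG; have : computable2 (fun o x y => F o x + y).
  apply: computable_addn; last exact: (computable_snd computable_id).
  exact: (computable_comp cF (computable_fst computable_id)).
move=> /computable_iter /(_ (computable_const 0) cG).
by apply: eq_computable => o x; elim: (G o x) => [|m /= ->]; rewrite ?muln0 ?mulnS.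
Qed.

Lemma computable_pred F : computable F -> computable (fun o x => (F o x).-1).
Proof.
move=> cF; have : computable3 (fun _ _ m _ => m).
  exact: (computable_fst (computable_snd computable_id)).
move=> /computable_primrec /(_ (computable_const 0) cF).
by apply: eq_computable => o x; case: (F o x).
Qed.

Lemma computable_subn F G :
  computable F -> computable G -> computable (fun o x => F o x - G o x).
Proof.
move=> cF cG; have : computable2 (fun _ _ y => y.-1).
  exact: (computable_pred (computable_snd computable_id)).
move=> /computable_iter /(_ cF cG); apply: eq_computable => o x.
by elim: (G o x) => [|m /= ->]; rewrite ?subn0 ?subnS.
Qed.

Lemma computable_if (P : (nat -> nat) -> nat -> bool) F G :
  computable (fun o x => P o x : nat) -> computable F -> computable G ->
  computable (fun o x => if P o x then F o x else G o x).
Proof.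
move=> cP cF cG.
have := computable_addn (computable_muln cP cF)
          (computable_muln (computable_subn (computable_const 1) cP) cG).
by apply: eq_computable => o x; case: (P o x); rewrite ?mul1n ?mul0n ?addn0.
Qed.

Lemma computable_leq F G :
  computable F -> computable G -> computable (fun o x => (F o x <= G o x : nat)).
Proof.
move=> cF cG; have := computable_subn (computable_const 1) (computable_subn cF cG).
by apply: eq_computable => o x; rewrite /leq; case: (F o x - G o x) => // m; rewrite eqn0Ngt.
Qed.

Lemma computable_negb (P : (nat -> nat) -> nat -> bool) :
  computable (fun o x => P o x : nat) -> computable (fun o x => ~~ P o x : nat).
Proof.
move=> cP; have := computable_subn (computable_const 1) cP.
by apply: eq_computable => o x; case: (P o x).
Qed.

Lemma computable_andb (P Q : (nat -> nat) -> nat -> bool) :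
  computable (fun o x => P o x : nat) -> computable (fun o x => Q o x : nat) ->
  computable (fun o x => P o x && Q o x : nat).
Proof.
move=> cP cQ; have := computable_muln cP cQ.
by apply: eq_computable => o x; case: (P o x); case: (Q o x).
Qed.

Lemma computable_implyb (P Q : (nat -> nat) -> nat -> bool) :
  computable (fun o x => P o x : nat) -> computable (fun o x => Q o x : nat) ->
  computable (fun o x => P o x ==> Q o x : nat).
Proof.
move=> cP cQ; have := computable_negb (computable_andb cP (computable_negb cQ)).
by apply: eq_computable => o x; case: (P o x); case: (Q o x).
Qed.

Lemma computable_odd F : computable F -> computable (fun o x => odd (F o x) : nat).
Proof.
move=> cF; have : computable2 (fun _ _ y => 1 - y).
  exact: (computable_subn (computable_const 1) (computable_snd computable_id)).
move=> /computable_iter /(_ (computable_const 0) cF); apply: eq_computable => o x.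
by elim: (F o x) => //= m ->; case: (odd m).
Qed.

Lemma computable_half F : computable F -> computable (fun o x => (F o x)./2).
Proof.
move=> cF; have : computable3 (fun _ _ m y => y + odd m).
  apply: computable_addn (computable_snd (computable_snd computable_id)) _.
  exact: computable_odd (computable_fst (computable_snd computable_id)).
move=> /computable_primrec /(_ (computable_const 0) cF); apply: eq_computable => o x.
by elim: (F o x) => //= m ->; rewrite uphalf_half addnC.
Qed.

Lemma computable_all (P : (nat -> nat) -> nat -> nat -> bool) F :
  computable2 (fun o x y => P o x y : nat) -> computable F ->
  computable (fun o x => all (P o x) (iota 0 (F o x)) : nat).
Proof.
move=> cP cF; have : computable3 (fun o x m y => y * P o x m).
  apply: computable_muln (computable_snd (computable_snd computable_id)) _.
  apply: (computable2_app cP) => //.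
    exact: (computable_fst computable_id).
  exact: (computable_fst (computable_snd computable_id)).
move=> /computable_primrec /(_ (computable_const 1) cF); apply: eq_computable => o x.
elim: (F o x) => // m IHm.
by rewrite /primrec -/primrec IHm -addn1 iotaD all_cat /= add0n andbT -mulnb.
Qed.

Lemma computable_has (P : (nat -> nat) -> nat -> nat -> bool) F :
  computable2 (fun o x y => P o x y : nat) -> computable F ->
  computable (fun o x => has (P o x) (iota 0 (F o x)) : nat).
Proof.
move=> cP cF.
have := computable_negb
  (computable_all (P := fun o x y => ~~ P o x y) (computable_negb cP) cF).
apply: eq_computable => o x; rewrite -has_predC; congr nat_of_bool.
by apply: eq_has => y; rewrite /= negbK.
Qed.

(** The index of the first hit is the number of initial segments [iota 0 m.+1] without a hit, a
    count obtained by recursion. Without any hit it is the full length, as for [find]. *)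
Lemma computable_find (P : (nat -> nat) -> nat -> nat -> bool) F :
  computable2 (fun o x y => P o x y : nat) -> computable F ->
  computable (fun o x => find (P o x) (iota 0 (F o x))).
Proof.
move=> cP cF.
have : computable3 (fun o x m y => y + ~~ has (P o x) (iota 0 m.+1)).
  apply: computable_addn (computable_snd (computable_snd computable_id)) _.
  apply: computable_negb.
  have c2 : computable2 (fun o x m => has (P o x) (iota 0 m.+1) : nat).
    apply: (@computable_has (fun o z y => P o (fst_nat z) y)).
      apply: (computable2_app cP); last exact: (computable_snd computable_id).
      exact: (computable_fst (computable_fst computable_id)).
    exact: (computable_succ (computable_snd computable_id)).
  apply: (computable2_app c2); first exact: (computable_fst computable_id).
  exact: (computable_fst (computable_snd computable_id)).
move=> /computable_primrec /(_ (computable_const 0) cF); apply: eq_computable => o x.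
elim: (F o x) => // m IHm; rewrite /primrec -/primrec IHm -addn1 iotaD find_cat has_cat.
case: ifPn => hP /=; rewrite ?orbT ?addn0 // size_iota hasNfind ?size_iota //= orbF.
by case: (P o x _).
Qed.

End Computable.

(** * The search *)

(** The nested format of [vec_of_nat], used at two levels: a polygon or a placement is a list of
    vectors, a vector is a list of rationals. Lists carry no length. *)
Definition node (m i : nat) : nat := fst_nat (iter i snd_nat m).

Lemma node0 a b : node (pair_nat a b) 0 = a.
Proof. exact: fst_pair_nat. Qed.

Lemma nodeS a b i : node (pair_nat a b) i.+1 = node b i.
Proof. by rewrite /node iterSr snd_pair_nat. Qed.

Lemma node_snd m i : node (snd_nat m) i = node m i.+1.
Proof. by rewrite /node iterSr. Qed.

(** The numerator is split into a positive and a negative part, one of them zero, so that rational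
    arithmetic runs on naturals without sign cases. The successor in [qneg] comes from [Negz a]
    being [- a.+1]. *)
Definition qpos m := if odd (fst_nat m) then 0 else (fst_nat m)./2.
Definition qneg m := if odd (fst_nat m) then (fst_nat m)./2.+1 else 0.
Definition qden m := (snd_nat m).+1.

(* A code of the rational [(a - b) / d], for [0 < d]. *)
Definition qfrac a b d :=
  pair_nat (if b <= a then (a - b) + (a - b) else ((b - a.+1) + (b - a.+1)).+1) d.-1.

Definition qnat a d := qfrac a 0 d.

Definition qadd x y := qfrac (qpos x * qden y + qpos y * qden x)
  (qneg x * qden y + qneg y * qden x) (qden x * qden y).
Definition qsub x y := qfrac (qpos x * qden y + qneg y * qden x)
  (qneg x * qden y + qpos y * qden x) (qden x * qden y).
Definition qmul x y := qfrac (qpos x * qpos y + qneg x * qneg y)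
  (qpos x * qneg y + qneg x * qpos y) (qden x * qden y).
(** Correct for positive [x] only; its value matters only at squared norms of nonzero mirrors. *)
Definition qinv x := qfrac (qden x) 0 (qpos x).
Definition qle x y :=
  qpos x * qden y + qneg y * qden x <= qpos y * qden x + qneg x * qden y.

Fixpoint vmap2 (f : nat -> nat -> nat) k a b :=
  if k is k'.+1 then
    pair_nat (f (fst_nat a) (fst_nat b)) (vmap2 f k' (snd_nat a) (snd_nat b))
  else 0.

Fixpoint vscale k c a :=
  if k is k'.+1 then pair_nat (qmul c (fst_nat a)) (vscale k' c (snd_nat a)) else 0.

Fixpoint vdot k a b :=
  if k is k'.+1 then
    qadd (qmul (fst_nat a) (fst_nat b)) (vdot k' (snd_nat a) (snd_nat b))
  else 0.

Definition vreflect n w x :=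
  vmap2 qsub n x (vscale n (qmul (qnat 2 1) (qmul (vdot n x w) (qinv (vdot n w w)))) w).

(* The first [k] entries of the code [m] are mirrors, applied in this order;
   the next one is a translation vector. *)
Fixpoint vplace n k m x :=
  if k is k'.+1 then vplace n k' (snd_nat m) (vreflect n (fst_nat m) x)
  else vmap2 qadd n x (fst_nat m).

(** Zero vectors are excluded because reflecting in one is the identity, and the parity of the
    number of mirrors would no longer give the determinant. *)
Fixpoint mirrors n k m :=
  if k is k'.+1 then
    ~~ qle (vdot n (fst_nat m) (fst_nat m)) 0 && mirrors n k' (snd_nat m)
  else true.

Definition pow2 s := iter s (fun y => y + y) 1.

Definition stream_bound k b := iter k (pair_nat b) 0.

(** * The tests of one stage *)

Section Search.
Variable n : nat.

Definition sqn a b := let d := vmap2 qsub n a b in vdot n d d.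

(** With [T = 2 ^ s], the [T ^ 2] edges make the motion along one edge at most [l / T ^ 2], which is
    below [1 / T] once [l <= T]. The grid step [T ^ -4] is so fine that rounding the vertices
    changes an edge by [2 n / T ^ 4 <= T ^ -3], that is, the speed by at most [1 / T], once
    [2 n <= T]. *)
Definition mesh s := pow2 s * pow2 s.
Definition grid s := mesh s * mesh s.
(* Bounds the codes of the multiples of [1 / grid s] in [[- pow2 s, pow2 s]]. *)
Definition coord_bound s := pair_nat (3 * (pow2 s * grid s)) (grid s).
Definition vec_bound s := stream_bound n (coord_bound s).
Definition path_bound s := stream_bound (mesh s).+1 (vec_bound s).
Definition place_bound s := stream_bound (n + n).+1 (vec_bound s).

(* Every coded placement moves some vertex of the polygon [p] to a point whose
   signed distance, as answered by the oracle, is at least [th]. *)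
Definition hits (o : nat -> nat) s th p :=
  all (fun m => mirrors n (n + n) m ==>
      has (fun i => qle th (o (pair_nat (vplace n (n + n) m (node p i)) s)))
        (iota 0 (mesh s).+1))
    (iota 0 (place_bound s).+1).

(** Speed at most [a / 2 ^ s], squared in order to stay rational: an edge lasts [1 / mesh s], and
    [grid s * mesh s] is the square of [2 ^ s * mesh s]. *)
Definition speed_le s p a :=
  all (fun i => qle (sqn (node p i.+1) (node p i)) (qnat (a * a) (grid s * mesh s)))
    (iota 0 (mesh s)).

(** Fixing the starting point removes the freedom of translation and makes the paths of bounded
    speed compact. *)
Definition based p := qle (vdot n (node p 0) (node p 0)) 0.

(* The thresholds [3 / 2 ^ s] here and [- 3 / 2 ^ s] in [candidate] exceed the sum
   of the errors of the oracle, of the polygon and of the net of placements. *)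
Definition escapable o s a :=
  has (fun g => [&& based g, speed_le s g a & hits o s (qnat 3 (pow2 s)) g])
    (iota 0 (path_bound s).+1).

(** An escapable [a] eventually forces [L <= a / 2 ^ s], and rounding a solution may cost one more
    unit of speed, hence [a.+1]. The range of [a] reaches the speed [mesh s / 2 ^ s = 2 ^ s], so it
    eventually passes [L]. *)
Definition candidate o s p :=
  [&& based p, hits o s (qfrac 0 3 (pow2 s)) p &
      all (fun a => escapable o s a ==> speed_le s p a.+1) (iota 0 (mesh s).+1)].

(** A rational time need not be a vertex time, so an entry is compared with all vertices within one
    time step; the slack in [close_sq] pays for this. *)
Definition near_index s t i :=
  let u := qnat i 1 in let v := qmul t (qnat (mesh s) 1) in
  qle (qsub u v) (qnat 1 1) && qle (qsub v u) (qnat 1 1).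

Definition close_sq s k :=
  let e := qadd (qnat 1 (pow2 k)) (qnat 1 (pow2 s)) in qmul e e.

Definition near s p q j :=
  (qle 0 (fst_nat j) && qle (fst_nat j) (qnat 1 1)) ==>
  all (fun i => near_index s (fst_nat j) i ==>
                qle (sqn (node p i) q) (close_sq s (snd_nat j)))
    (iota 0 (mesh s).+1).

(* [h] lists the guesses for the entries [j - 1, ..., 0], in this order. *)
Definition consistent o s j h :=
  has (fun p => candidate o s p &&
                all (fun i => near s p (node h i) (j - i.+1)) (iota 0 j))
    (iota 0 (path_bound s).+1).

(** All entries are recomputed at the same stage. Searching below [s] keeps the stage finite, and
    [s] eventually exceeds the right code; if no code passes, the entry is [s], which is harmless at
    early stages. *)
Definition history o s j :=
  primrec (fun i h =>
    pair_nat (find (fun v => consistent o s i.+1 (pair_nat v h)) (iota 0 s)) h) 0 j.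

Definition guess_of o x := fst_nat (history o (snd_nat x) (fst_nat x).+1).

End Search.

(** * Computability of the search *)

Ltac unfold_computable :=
  cbv beta delta [computable2 computable3 computable4].

Ltac computable_step := unfold_computable; lazymatch goal with
  | |- computable (fun _ x => x) => exact: computable_id
  | |- computable (fun _ _ => ?k) => exact: (computable_const k)
  | |- computable (fun o x => pair_nat (@?F o x) (@?G o x)) =>
    apply: (@computable_pair F G)
  | |- computable (fun o x => fst_nat (@?F o x)) => apply: (@computable_fst F)
  | |- computable (fun o x => snd_nat (@?F o x)) => apply: (@computable_snd F)
  | |- computable (fun o x => nat_of_bool (leq (@?F o x) (@?G o x))) =>
    apply: (@computable_leq F G)
  | |- computable (fun o x => nat_of_bool (negb (@?P o x))) =>
    apply: (@computable_negb P)
  | |- computable (fun o x => nat_of_bool (andb (@?P o x) (@?Q o x))) =>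
    apply: (@computable_andb P Q)
  | |- computable (fun o x => nat_of_bool (implb (@?P o x) (@?Q o x))) =>
    apply: (@computable_implyb P Q)
  | |- computable (fun o x => nat_of_bool (odd (@?F o x))) => apply: (@computable_odd F)
  | |- computable (fun o x => nat_of_bool (all (@?P o x) (iota 0 (@?F o x)))) =>
    apply: (@computable_all P F)
  | |- computable (fun o x => nat_of_bool (has (@?P o x) (iota 0 (@?F o x)))) =>
    apply: (@computable_has P F)
  | |- computable (fun o x => find (@?P o x) (iota 0 (@?F o x))) =>
    apply: (@computable_find P F)
  | |- computable (fun o x => half (@?F o x)) => apply: (@computable_half F)
  | |- computable (fun o x => predn (@?F o x)) => apply: (@computable_pred F)
  | |- computable (fun o x => subn (@?F o x) (@?G o x)) => apply: (@computable_subn F G)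
  | |- computable (fun o x => addn (@?F o x) (@?G o x)) => apply: (@computable_addn F G)
  | |- computable (fun o x => muln (@?F o x) (@?G o x)) => apply: (@computable_muln F G)
  | |- computable (fun o x => S (@?F o x)) => apply: (@computable_succ F)
  | |- computable (fun o x => if _ then _ else _) => apply: computable_if
  | _ => apply: computable_oracle
  end.

Lemma computable_node : computable2 (fun _ => node).
Proof.
apply: computable_fst; apply: (@computable_iter (fun _ _ => snd_nat));
  by repeat computable_step.
Qed.

Lemma computable_qpos : computable (fun _ => qpos).
Proof. by rewrite /qpos; repeat computable_step. Qed.
Lemma computable_qneg : computable (fun _ => qneg).
Proof. by rewrite /qneg; repeat computable_step. Qed.
Lemma computable_qden : computable (fun _ => qden).
Proof. by rewrite /qden; repeat computable_step. Qed.

Ltac computable_step1 := unfold_computable; lazymatch goal with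
  | |- computable (fun o x => node (@?F o x) (@?G o x)) =>
    apply: (@computable2_app (fun _ => node) F G computable_node)
  | |- computable (fun o x => qpos (@?F o x)) =>
    apply: (@computable_comp (fun _ => qpos) F computable_qpos)
  | |- computable (fun o x => qneg (@?F o x)) =>
    apply: (@computable_comp (fun _ => qneg) F computable_qneg)
  | |- computable (fun o x => qden (@?F o x)) =>
    apply: (@computable_comp (fun _ => qden) F computable_qden)
  | _ => computable_step
  end.

Lemma computable_qfrac : computable3 (fun _ => qfrac).
Proof. by rewrite /qfrac; repeat computable_step1. Qed.

Lemma computable_qnat : computable2 (fun _ => qnat).
Proof. by rewrite /qnat; apply: (computable3_app computable_qfrac); repeat computable_step1. Qed.

Ltac computable_step2 := unfold_computable; lazymatch goal with
  | |- computable (fun o x => qfrac (@?F o x) (@?G o x) (@?H o x)) =>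
    apply: (@computable3_app (fun _ => qfrac) F G H computable_qfrac)
  | |- computable (fun o x => qnat (@?F o x) (@?G o x)) =>
    apply: (@computable2_app (fun _ => qnat) F G computable_qnat)
  | _ => computable_step1
  end.

Lemma computable_qadd : computable2 (fun _ => qadd).
Proof. by rewrite /qadd; repeat computable_step2. Qed.
Lemma computable_qsub : computable2 (fun _ => qsub).
Proof. by rewrite /qsub; repeat computable_step2. Qed.
Lemma computable_qmul : computable2 (fun _ => qmul).
Proof. by rewrite /qmul; repeat computable_step2. Qed.
Lemma computable_qinv : computable (fun _ => qinv).
Proof. by rewrite /qinv; repeat computable_step2. Qed.
Lemma computable_qle : computable2 (fun _ x y => qle x y : nat).
Proof. by rewrite /qle; repeat computable_step2. Qed.

Ltac computable_step3 := unfold_computable; lazymatch goal with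
  | |- computable (fun o x => qadd (@?F o x) (@?G o x)) =>
    apply: (@computable2_app (fun _ => qadd) F G computable_qadd)
  | |- computable (fun o x => qsub (@?F o x) (@?G o x)) =>
    apply: (@computable2_app (fun _ => qsub) F G computable_qsub)
  | |- computable (fun o x => qmul (@?F o x) (@?G o x)) =>
    apply: (@computable2_app (fun _ => qmul) F G computable_qmul)
  | |- computable (fun o x => nat_of_bool (qle (@?F o x) (@?G o x))) =>
    apply: (@computable2_app (fun _ a b => nat_of_bool (qle a b)) F G computable_qle)
  | |- computable (fun o x => qinv (@?F o x)) =>
    apply: (@computable_comp (fun _ => qinv) F computable_qinv)
  | _ => computable_step2
  end.

(** The dimension is fixed before the program, so the recursion on [k] is unrolled into a program
    that depends on [k]. *)
Lemma computable_vmap2 f k :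
  computable2 (fun _ => f) -> computable2 (fun _ => vmap2 f k).
Proof.
move=> cf; elim: k => [|k IHk] /=; first exact: computable_const.
apply: computable_pair; first by apply: (computable2_app cf); repeat computable_step.
by apply: (computable2_app IHk); repeat computable_step.
Qed.

Lemma computable_vscale k : computable2 (fun _ => vscale k).
Proof.
elim: k => [|k IHk] /=; first exact: computable_const.
apply: computable_pair; first by repeat computable_step3.
by apply: (computable2_app IHk); repeat computable_step.
Qed.

Lemma computable_vdot k : computable2 (fun _ => vdot k).
Proof.
elim: k => [|k IHk] /=; first exact: computable_const.
apply: (computable2_app computable_qadd); first by repeat computable_step3.
by apply: (computable2_app IHk); repeat computable_step.
Qed.

Ltac computable_step4 := unfold_computable; lazymatch goal with
  | |- computable (fun o x => vmap2 qadd ?k (@?F o x) (@?G o x)) =>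
    apply: (@computable2_app (fun _ => vmap2 qadd k) F G (computable_vmap2 k computable_qadd))
  | |- computable (fun o x => vmap2 qsub ?k (@?F o x) (@?G o x)) =>
    apply: (@computable2_app (fun _ => vmap2 qsub k) F G (computable_vmap2 k computable_qsub))
  | |- computable (fun o x => vscale ?k (@?F o x) (@?G o x)) =>
    apply: (@computable2_app (fun _ => vscale k) F G (computable_vscale k))
  | |- computable (fun o x => vdot ?k (@?F o x) (@?G o x)) =>
    apply: (@computable2_app (fun _ => vdot k) F G (computable_vdot k))
  | _ => computable_step3
  end.

Lemma computable_vreflect n : computable2 (fun _ => vreflect n).
Proof. by rewrite /vreflect; repeat computable_step4. Qed.

Lemma computable_vplace n k : computable2 (fun _ => vplace n k).
Proof.
elim: k => [|k IHk] /=; first by repeat computable_step4.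
apply: (computable2_app IHk); first by repeat computable_step.
by apply: (computable2_app (computable_vreflect n)); repeat computable_step.
Qed.

Lemma computable_mirrors n k : computable (fun _ x => mirrors n k x : nat).
Proof.
elim: k => [|k IHk] /=; first exact: computable_const.
apply: computable_andb; first by repeat computable_step4.
by apply: (computable_comp IHk); repeat computable_step.
Qed.

Lemma computable_pow2 : computable (fun _ => pow2).
Proof.
by rewrite /pow2; apply: (@computable_iter (fun _ _ y => y + y)); repeat computable_step.
Qed.

Lemma computable_stream_bound : computable2 (fun _ => stream_bound).
Proof.
rewrite /stream_bound; apply: (@computable_iter (fun o x => pair_nat (snd_nat x)));
  by repeat computable_step.
Qed.

Lemma computable_mesh : computable (fun _ => mesh).
Proof.
by rewrite /mesh; apply: computable_muln; exact: computable_pow2.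
Qed.

Lemma computable_grid : computable (fun _ => grid).
Proof. by rewrite /grid; apply: computable_muln; exact: computable_mesh. Qed.

Ltac computable_step5 := unfold_computable; lazymatch goal with
  | |- computable (fun o x => mesh (@?F o x)) =>
    apply: (@computable_comp (fun _ => mesh) F computable_mesh)
  | |- computable (fun o x => grid (@?F o x)) =>
    apply: (@computable_comp (fun _ => grid) F computable_grid)
  | |- computable (fun o x => pow2 (@?F o x)) =>
    apply: (@computable_comp (fun _ => pow2) F computable_pow2)
  | |- computable (fun o x => stream_bound (@?F o x) (@?G o x)) =>
    apply: (@computable2_app (fun _ => stream_bound) F G computable_stream_bound)
  | |- computable (fun o x => vplace ?k ?l (@?F o x) (@?G o x)) =>
    apply: (@computable2_app (fun _ => vplace k l) F G (computable_vplace k l))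
  | |- computable (fun o x => nat_of_bool (mirrors ?k ?l (@?F o x))) =>
    apply: (@computable_comp (fun _ y => nat_of_bool (mirrors k l y)) F (computable_mirrors k l))
  | _ => computable_step4
  end.

Section SearchComputable.
Variable n : nat.

Lemma computable_vec_bound : computable (fun _ => vec_bound n).
Proof. by rewrite /vec_bound /coord_bound; repeat computable_step5. Qed.

Lemma computable_path_bound : computable (fun _ => path_bound n).
Proof.
rewrite /path_bound; apply: (computable2_app computable_stream_bound).
  by repeat computable_step5.
exact: computable_vec_bound.
Qed.

Lemma computable_place_bound : computable (fun _ => place_bound n).
Proof.
rewrite /place_bound; apply: (computable2_app computable_stream_bound).
  by repeat computable_step5.
exact: computable_vec_bound.
Qed.

Lemma computable_sqn : computable2 (fun _ => sqn n).
Proof. by rewrite /sqn; repeat computable_step5. Qed.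

Lemma computable_hits : computable3 (fun o s th p => hits n o s th p : nat).
Proof.
rewrite /hits; unfold_computable.
apply: (@computable_all (fun o z m => _)); last first.
  apply: computable_succ; apply: (computable_comp computable_place_bound).
  by repeat computable_step.
unfold_computable; apply: computable_implyb; first by repeat computable_step5.
apply: (@computable_has (fun o z i => _)); last by repeat computable_step5.
by repeat computable_step5.
Qed.

Lemma computable_speed_le : computable3 (fun o s p a => speed_le n s p a : nat).
Proof.
rewrite /speed_le; unfold_computable.
apply: (@computable_all (fun o z m => _)); last by repeat computable_step5.
unfold_computable; apply: (computable2_app computable_qle); last by repeat computable_step5.
by apply: (computable2_app computable_sqn); repeat computable_step5.
Qed.

Lemma computable_based : computable (fun o p => based n p : nat).
Proof. by rewrite /based; repeat computable_step5. Qed.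

Lemma computable_escapable : computable2 (fun o s a => escapable n o s a : nat).
Proof.
rewrite /escapable; unfold_computable.
apply: (@computable_has (fun o z g => _)); last first.
  apply: computable_succ; apply: (computable_comp computable_path_bound).
  by repeat computable_step.
unfold_computable; apply: computable_andb.
  by apply: (computable_comp computable_based); repeat computable_step.
apply: computable_andb.
  by apply: (computable3_app computable_speed_le); repeat computable_step.
by apply: (computable3_app computable_hits); repeat computable_step5.
Qed.

Lemma computable_candidate : computable2 (fun o s p => candidate n o s p : nat).
Proof.
rewrite /candidate; unfold_computable; apply: computable_andb.
  by apply: (computable_comp computable_based); repeat computable_step.
apply: computable_andb.
  by apply: (computable3_app computable_hits); repeat computable_step5.
apply: (@computable_all (fun o z a => _)); last by repeat computable_step5.
unfold_computable; apply: computable_implyb.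
  by apply: (computable2_app computable_escapable); repeat computable_step.
by apply: (computable3_app computable_speed_le); repeat computable_step.
Qed.

Lemma computable_near : computable4 (fun o s p q j => near n s p q j : nat).
Proof.
rewrite /near; unfold_computable; apply: computable_implyb.
  by repeat computable_step5.
apply: (@computable_all (fun o z i => _)); last by repeat computable_step5.
unfold_computable; apply: computable_implyb.
  by rewrite /near_index; repeat computable_step5.
apply: (computable2_app computable_qle).
  by apply: (computable2_app computable_sqn); repeat computable_step5.
by rewrite /close_sq; repeat computable_step5.
Qed.

Lemma computable_consistent : computable3 (fun o s j h => consistent n o s j h : nat).
Proof.
rewrite /consistent; unfold_computable.
apply: (@computable_has (fun o z p => _)); last first.
  apply: computable_succ; apply: (computable_comp computable_path_bound).
  by repeat computable_step.
unfold_computable; apply: computable_andb.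
  by apply: (computable2_app computable_candidate); repeat computable_step.
apply: (@computable_all (fun o z i => _)); last by repeat computable_step5.
by unfold_computable; apply: (computable4_app computable_near); repeat computable_step5.
Qed.

Lemma computable_history : computable2 (fun o s j => history n o s j).
Proof.
rewrite /history; unfold_computable.
apply: (@computable_primrec (fun o z i h => _));
  [|exact: computable_const|by repeat computable_step].
unfold_computable; apply: computable_pair; last by repeat computable_step.
apply: (@computable_find (fun o z v => _)); last by repeat computable_step.
by unfold_computable; apply: (computable3_app computable_consistent); repeat computable_step.
Qed.

Lemma computable_guess_of : computable (fun o x => guess_of n o x).
Proof.
rewrite /guess_of; apply: computable_fst.
by apply: (computable2_app computable_history); repeat computable_step.
Qed.

End SearchComputable.

Local Open Scope classical_set_scope.
Local Open Scope ring_scope.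

(** * Euclidean geometry *)

Section Euclidean.
Variables (R : realType) (n : nat).
Implicit Types (x y z w : 'rV[R]_n) (M : 'M[R]_n).

Definition dot x y : R := \sum_(i < n) x 0 i * y 0 i.

Lemma dotC x y : dot x y = dot y x.
Proof. by apply: eq_bigr => i _; rewrite mulrC. Qed.

Lemma dotDl x y z : dot (x + y) z = dot x z + dot y z.
Proof. by rewrite /dot -big_split; apply: eq_bigr => i _; rewrite mxE mulrDl. Qed.

Lemma dotZl a x y : dot (a *: x) y = a * dot x y.
Proof. by rewrite /dot mulr_sumr; apply: eq_bigr => i _; rewrite mxE mulrA. Qed.

Lemma dotDr x y z : dot x (y + z) = dot x y + dot x z.
Proof. by rewrite dotC dotDl !(dotC _ x). Qed.

Lemma dotZr a x y : dot x (a *: y) = a * dot x y.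
Proof. by rewrite dotC dotZl dotC. Qed.

Lemma dotNl x y : dot (- x) y = - dot x y.
Proof. by rewrite -scaleN1r dotZl mulN1r. Qed.

Lemma dotNr x y : dot x (- y) = - dot x y.
Proof. by rewrite dotC dotNl dotC. Qed.

Lemma dot0l x : dot 0 x = 0.
Proof. by rewrite /dot big1 // => i _; rewrite mxE mul0r. Qed.

Definition dotE := (dotDl, dotDr, dotNl, dotNr, dotZl, dotZr).

Lemma dot_ge0 x : 0 <= dot x x.
Proof. by apply: sumr_ge0 => i _; rewrite -expr2 sqr_ge0. Qed.

Lemma dot_eq0 x : (dot x x == 0) = (x == 0).
Proof.
apply/eqP/eqP => [/eqP|->]; last by rewrite dot0l.
rewrite psumr_eq0 => [/allP x0|i _]; last by rewrite -expr2 sqr_ge0.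
apply/rowP => i; rewrite mxE; apply/eqP.
by have := x0 i (mem_index_enum _); rewrite /= mulf_eq0 orbb.
Qed.

Lemma dot_gt0 x : (0 < dot x x) = (x != 0).
Proof. by rewrite lt0r dot_eq0 dot_ge0 andbT. Qed.

Lemma dot_delta i j : dot (delta_mx 0 i) (delta_mx 0 j) = (i == j)%:R.
Proof.
rewrite /dot (bigD1 i) //= big1 ?addr0 => [|m /negPf mi]; last by rewrite !mxE mi andbF mul0r.
by rewrite !mxE !eqxx mul1r.
Qed.

Lemma enormE x : enorm x = Num.sqrt (dot x x).
Proof. by congr Num.sqrt; apply: eq_bigr => i _; rewrite expr2. Qed.

Lemma enorm_ge0 x : 0 <= enorm x.
Proof. exact: sqrtr_ge0. Qed.

Lemma enorm_sq x : enorm x ^+ 2 = dot x x.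
Proof. by rewrite enormE sqr_sqrtr ?dot_ge0. Qed.

Lemma enorm_eq0 x : (enorm x == 0) = (x == 0).
Proof. by rewrite -dot_eq0 -enorm_sq sqrf_eq0. Qed.

Lemma enorm0 : enorm (0 : 'rV[R]_n) = 0.
Proof. by apply/eqP; rewrite enorm_eq0. Qed.

Lemma enorm_gt0 x : (0 < enorm x) = (x != 0).
Proof. by rewrite lt0r enorm_eq0 enorm_ge0 andbT. Qed.

Lemma enormN x : enorm (- x) = enorm x.
Proof. by rewrite !enormE !dotE opprK. Qed.

Lemma enormZ a x : enorm (a *: x) = `|a| * enorm x.
Proof. by rewrite !enormE !dotE mulrA -expr2 sqrtrM ?sqr_ge0 // sqrtr_sqr. Qed.

Lemma enormB x y : enorm (x - y) = enorm (y - x).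
Proof. by rewrite -enormN opprB. Qed.

Lemma enorm_le x (c : R) : 0 <= c -> (enorm x <= c) = (dot x x <= c ^+ 2).
Proof. by move=> c0; rewrite -enorm_sq ler_sqr ?nnegrE ?enorm_ge0. Qed.

Lemma cauchy_schwarz x y : `|dot x y| <= enorm x * enorm y.
Proof.
rewrite -ler_sqr ?nnegrE ?mulr_ge0 ?enorm_ge0 // real_normK ?num_real // exprMn !enorm_sq.
have [->|y0] := eqVneq y 0; first by rewrite dotC !dot0l expr0n mulr0.
have := dot_ge0 (dot y y *: x - dot x y *: y); rewrite !dotE (dotC y x).
rewrite [X in 0 <= X](_ : _ = dot y y * (dot x x * dot y y - dot x y ^+ 2)); last by ring.
rewrite pmulr_rge0 ?dot_gt0 // subr_ge0 //.
Qed.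

Lemma enorm_triangle x y : enorm (x + y) <= enorm x + enorm y.
Proof.
rewrite enorm_le ?addr_ge0 ?enorm_ge0 // sqrrD !enorm_sq !dotE (dotC y x).
by have := le_trans (ler_norm _) (cauchy_schwarz x y); lra.
Qed.

Lemma enorm_distD y x z : enorm (x - z) <= enorm (x - y) + enorm (y - z).
Proof. by apply: le_trans (enorm_triangle _ _); rewrite addrA subrK. Qed.

Lemma enorm_lerB x y : enorm x - enorm y <= enorm (x - y).
Proof. by rewrite lerBlDr; have := enorm_triangle (x - y) y; rewrite subrK. Qed.

Lemma enorm_coord x i : `|x 0 i| <= enorm x.
Proof.
rewrite -ler_sqr ?nnegrE ?enorm_ge0 // real_normK ?num_real // enorm_sq.
by rewrite /dot (bigD1 i) //= expr2 lerDl sumr_ge0 // => j _; rewrite -expr2 sqr_ge0.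
Qed.

Lemma enorm_le_coord x (c : R) : 0 <= c -> (forall i, `|x 0 i| <= c) -> enorm x <= n%:R * c.
Proof.
move=> c0 xc; rewrite enorm_le ?mulr_ge0 // exprMn.
apply: (@le_trans _ _ (n%:R * c ^+ 2)).
  rewrite -[X in X%:R]card_ord mulr_natl -sumr_const; apply: ler_sum => i _.
  by rewrite -expr2 -real_normK ?num_real // ler_sqr ?nnegrE.
by rewrite ler_wpM2r ?sqr_ge0 // -natrX ler_nat; case: (n) => // m; rewrite leq_pmulr.
Qed.

Lemma enorm_sum (I : Type) (r : seq I) (F : I -> 'rV[R]_n) :
  enorm (\sum_(i <- r) F i) <= \sum_(i <- r) enorm (F i).
Proof.
elim/big_rec2: _ => [|i a x _ le_ax]; first by rewrite enorm0.
exact: le_trans (enorm_triangle _ _) (lerD _ _).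
Qed.

Lemma norm_le_enorm x : `|x| <= enorm x.
Proof.
rewrite -[`|x|]/(mx_norm x) mx_normrE; apply/bigmax_leP.
split => [|[i j] _]; first exact: enorm_ge0.
by rewrite /= ord1 enorm_coord.
Qed.

Lemma enorm_le_norm x : enorm x <= n%:R * `|x|.
Proof.
apply: enorm_le_coord => // i; rewrite -[`|x|]/(mx_norm x) mx_normrE.
by apply/bigmax_geP; right; exists (0, i).
Qed.

(** * Reflections and their products *)

Definition reflection w x := x - (2 * (dot x w / dot w w)) *: w.

Definition mirror_mx w : 'M[R]_n := 1%:M - (2 / dot w w) *: (w^T *m w).

Lemma mul_mirror_mx w x : x *m mirror_mx w = reflection w x.
Proof.
rewrite mulmxBr mulmx1 -scalemxAr mulmxA; congr (_ - _).
have -> : x *m w^T = (dot x w)%:M.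
  by rewrite [LHS]mx11_scalar !mxE; congr _%:M; apply: eq_bigr => i _; rewrite mxE.
by rewrite mul_scalar_mx scalerA; congr (_ *: _); ring.
Qed.

Lemma reflection0 x : reflection 0 x = x.
Proof. by rewrite /reflection scaler0 subr0. Qed.

Lemma reflectionZ a w x : a != 0 -> reflection (a *: w) x = reflection w x.
Proof.
move=> a0; rewrite /reflection !dotE scalerA; have [->|w0] := eqVneq w 0; first by rewrite !scaler0.
by congr (_ - _ *: _); field; rewrite a0 dot_eq0 w0.
Qed.

Lemma dot_reflection w x y : dot (reflection w x) (reflection w y) = dot x y.
Proof.
have [->|w0] := eqVneq w 0; first by rewrite !reflection0.
by rewrite /reflection !dotE (dotC w y); field; rewrite dot_eq0.
Qed.

Lemma enorm_reflection w x : enorm (reflection w x) = enorm x.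
Proof. by rewrite !enormE dot_reflection. Qed.

(** The matrix determinant lemma: one bordered matrix has two block triangular factorizations, by
    eliminating either diagonal block, and their determinants agree. *)
Lemma det_add_rank1 m (u : 'cV[R]_m) (v : 'rV[R]_m) :
  \det (1%:M + u *m v) = 1 + (v *m u) 0 0.
Proof.
have e1 : block_mx 1%:M (- v) u 1%:M =
    block_mx 1%:M 0 u 1%:M *m block_mx 1%:M (- v) 0 (1%:M + u *m v).
  rewrite mulmx_block !(mul1mx, mul0mx, mulmx1, mulmx0, addr0, add0r) mulmxN.
  by rewrite addrC addrK.
have e2 : block_mx 1%:M (- v) u 1%:M =
    block_mx 1%:M (- v) 0 1%:M *m block_mx (1%:M + v *m u) 0 u 1%:M.
  by rewrite mulmx_block !(mul1mx, mul0mx, mulmx1, mulmx0, addr0, add0r) mulNmx addrK.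
have := congr1 determinant e1; rewrite e2 !det_mulmx !det_ublock !det_lblock !det1 !mul1r mulr1.
by move=> <-; rewrite det_mx11 !mxE eqxx.
Qed.

Lemma det_mirror_mx w : w != 0 -> \det (mirror_mx w) = -1.
Proof.
move=> w0; rewrite /mirror_mx -scaleNr scalemxAl det_add_rank1.
have -> : (w *m (- (2 / dot w w) *: w^T)) 0 0 = - (2 / dot w w) * dot w w.
  rewrite -scalemxAr mxE; congr (_ * _); rewrite mxE.
  by apply: eq_bigr => i _; rewrite mxE.
by field; rewrite dot_eq0.
Qed.

Lemma mirror_mxK w : mirror_mx w *m mirror_mx w = 1%:M.
Proof.
apply/row_matrixP => i; rewrite row_mul mul_mirror_mx !rowE mul_mirror_mx mulmx1.
set x := delta_mx 0 i; have [->|w0] := eqVneq w 0; first by rewrite !reflection0.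
rewrite {1}/reflection /reflection !dotE -addrA -opprD -scalerDl.
rewrite [X in X *: _](_ : _ = 0) ?scale0r ?subr0 //.
by field; rewrite dot_eq0.
Qed.

Definition mirrors_mx (ws : seq 'rV[R]_n) : 'M[R]_n :=
  foldl (fun M w => M *m mirror_mx w) 1%:M ws.

Lemma mirrors_mx_rcons ws w : mirrors_mx (rcons ws w) = mirrors_mx ws *m mirror_mx w.
Proof. by rewrite /mirrors_mx foldl_rcons. Qed.

Lemma mul_mirrors_mx ws x : x *m mirrors_mx ws = foldl (fun y w => reflection w y) x ws.
Proof.
elim/last_ind: ws => [|ws w IHws]; first by rewrite mulmx1.
by rewrite mirrors_mx_rcons mulmxA IHws foldl_rcons mul_mirror_mx.
Qed.

Lemma det_mirrors_mx ws : all (fun w => w != 0) ws -> \det (mirrors_mx ws) = (-1) ^+ size ws.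
Proof.
elim/last_ind: ws => [|ws w IHws]; first by rewrite det1.
rewrite all_rcons => /andP[w0 /IHws ws0].
by rewrite mirrors_mx_rcons det_mulmx det_mirror_mx // ws0 size_rcons exprSr.
Qed.

Definition orthogonal_mx M := forall x y, dot (x *m M) (y *m M) = dot x y.

(* Cartan-Dieudonne: reflecting [M e_j] back to [e_j] fixes one more basis
   vector and leaves the fixed ones fixed. *)
Lemma orthogonal_mirrors_fix k M : (k <= n)%N -> orthogonal_mx M ->
  (forall i : 'I_n, (i < n - k)%N ->
     (delta_mx 0 i : 'rV[R]_n) *m M = delta_mx 0 i) ->
  exists ws, [/\ (size ws <= k)%N, all (fun w => dot w w == 1) ws & M = mirrors_mx ws].
Proof.
elim: k M => [|k IHk] M kn oM fM.
  exists [::]; split=> //; apply/row_matrixP => i.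
  by rewrite !rowE mulmx1 fM // subn0.
have jP : (n - k.+1 < n)%N by lia.
pose j := Ordinal jP; pose e i : 'rV[R]_n := delta_mx 0 i.
pose w := e j *m M - e j.
have fj : reflection w (e j *m M) = e j.
  have [w0|w0] := eqVneq w 0.
    by rewrite w0 reflection0; apply/eqP; rewrite -subr_eq0 -/w w0.
  have -> : e j *m M = w + e j by rewrite subrK.
  (* Since [M] preserves the norm of [e j], the midpoint of [e j] and its image is orthogonal to
     [w], so it lies on the mirror. *)
  have ww : 2 * dot (e j) w = - dot w w.
    by rewrite /w !dotE oM (dotC (_ *m M)); ring.
  rewrite /reflection dotDl [X in X *: w](_ : _ = 1) ?scale1r; first by rewrite addrC addKr.
  have -> : 2 * ((dot w w + dot (e j) w) / dot w w) = (2 * dot w w + 2 * dot (e j) w) / dot w w.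
    by rewrite mulrA mulrDr.
  by rewrite ww; field; rewrite dot_eq0.
have fi (i : 'I_n) : (i < j)%N -> reflection w (e i) = e i.
  move=> ij; rewrite /reflection [X in 2 * (X / _)](_ : _ = 0) ?(mul0r, mulr0, scale0r, subr0) //.
  by rewrite /w !dotE -(oM (e i) (e j)) (fM i ij) subrr.
have oM' : orthogonal_mx (M *m mirror_mx w).
  by move=> x y; rewrite !mulmxA !mul_mirror_mx dot_reflection.
have fM' (i : 'I_n) : (i < n - k)%N -> e i *m (M *m mirror_mx w) = e i.
  move=> ik; rewrite mulmxA mul_mirror_mx.
  have [ij|ij] := ltnP i j; first by rewrite fM // fi.
  by rewrite (_ : i = j) ?fj //; apply: val_inj; rewrite /= in ij *; lia.
have [ws [sz ws1 Mws]] := IHk _ (ltnW kn) oM' fM'.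
have MK : M = mirrors_mx ws *m mirror_mx w by rewrite -Mws -mulmxA mirror_mxK mulmx1.
have [w0|w0] := eqVneq w 0.
  by exists ws; split; rewrite ?(leq_trans sz) // MK w0 /mirror_mx mulmx0 scaler0 subr0 mulmx1.
exists (rcons ws ((enorm w)^-1 *: w)); split; rewrite ?size_rcons //.
  by rewrite all_rcons ws1 andbT dotZl dotZr -enorm_sq; apply/eqP; field; rewrite enorm_eq0.
rewrite mirrors_mx_rcons MK; congr (_ *m _); apply/row_matrixP => i.
by rewrite !rowE !mul_mirror_mx reflectionZ // invr_eq0 enorm_eq0.
Qed.

(** A fixed number of mirrors gives all placement codes the same shape. A positive determinant makes
    the number of mirrors even, so the list can be padded to the even length [n + n] by pairs of
    equal mirrors, which cancel. *)
Lemma orthogonal_mirrors M : (0 < n)%N -> orthogonal_mx M -> 0 < \det M ->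
  exists ws, [/\ size ws = (n + n)%N, all (fun w => dot w w == 1) ws & M = mirrors_mx ws].
Proof.
move=> n0 oM dM.
have [|ws [sz ws1 Mws]] := @orthogonal_mirrors_fix n M (leqnn n) oM.
  by move=> i; rewrite subnn.
have unit_neq0 (w : 'rV[R]_n) : dot w w == 1 -> w != 0.
  by move=> /eqP w1; rewrite -dot_eq0 w1 oner_eq0.
have even_ws : odd (size ws) = false.
  move: dM; rewrite Mws det_mirrors_mx ?(sub_all unit_neq0) // -signr_odd.
  by case: odd => //; rewrite expr1 oppr_gt0 ltr10.
pose e : 'rV[R]_n := delta_mx 0 (Ordinal n0).
have e1 : dot e e == 1 by rewrite dot_delta eqxx.
exists (ws ++ nseq (n + n - size ws) e); split.
- by rewrite size_cat size_nseq subnKC // (leq_trans sz) ?leq_addr.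
- by rewrite all_cat ws1 all_nseq e1 orbT.
have -> : (n + n - size ws = ((n + n - size ws)./2).*2)%N.
  by rewrite even_halfK // oddB ?(leq_trans sz) ?leq_addr // even_ws oddD addbb.
elim: (_./2) => [|k IHk]; first by rewrite cats0.
rewrite doubleS /= -cat_rcons -cat_rcons.
rewrite /mirrors_mx foldl_cat !foldl_rcons -mulmxA mirror_mxK mulmx1 -foldl_cat //.
Qed.

End Euclidean.

(** * Signed distances *)

Section SignedDistance.
Variables (R : realType) (n : nat).
Implicit Types (A B : set 'rV[R]_n) (x y z : 'rV[R]_n).

Lemma nbhs_enorm_ball x (e : R) : 0 < e -> nbhs x [set y | enorm (x - y) < e].
Proof.
move=> e0; have d0 : 0 < e / n.+1%:R by rewrite divr_gt0 ?ltr0n.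
apply: filterS (nbhsx_ballx x _ d0) => y; rewrite -ball_normE /= => xy.
apply: le_lt_trans (enorm_le_norm _) _.
apply: le_lt_trans (_ : n.+1%:R * `|x - y| < e); first by rewrite ler_wpM2r // ler_nat.
by rewrite mulrC -ltr_pdivlMr ?ltr0n.
Qed.

Lemma nbhs_enormP x (U : set 'rV[R]_n) :
  nbhs x U <-> exists2 e : R, 0 < e & forall y, enorm (x - y) < e -> U y.
Proof.
split=> [/nbhs_ballP[e e0 xU]|[e e0 xU]]; last exact: filterS (nbhs_enorm_ball x e0).
exists e => // y xy; apply: xU; rewrite -ball_normE /=.
exact: le_lt_trans (norm_le_enorm _) xy.
Qed.

Lemma closure_enormP A x :
  closure A x <-> forall e : R, 0 < e -> exists2 y, A y & enorm (x - y) < e.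
Proof.
split=> [cl e e0|ex U /nbhs_enormP[e e0 eU]].
  by have [y [Ay xy]] := cl _ (nbhs_enorm_ball x e0); exists y.
by have [y Ay /eU Uy] := ex e e0; exists y.
Qed.

(** The supremum of the times at which the segment from [x] to [y] is in [A] gives a boundary point;
    lying on the segment, it splits the distance additively. *)
Lemma boundary_crossing A x y : A x -> ~ A y ->
  exists2 z, boundary A z & enorm (x - z) + enorm (z - y) = enorm (x - y).
Proof.
move=> Ax nAy; pose g (t : R) := x + t *: (y - x).
pose E := [set t : R | 0 <= t <= 1 /\ A (g t)].
have E0 : E 0 by split; rewrite ?lexx ?ler01 // /g scale0r addr0.
have E1 : ubound E 1 by move=> t [/andP[]].
have supE : has_sup E by split; [exists 0|exists 1].
pose c := sup E.
have c0 : 0 <= c by apply: ub_le_sup => //; exists 1.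
have c1 : c <= 1 by apply: ge_sup => //; exists 0.
have gB s t : enorm (g s - g t) = `|s - t| * enorm (y - x).
  by rewrite /g opprD addrACA subrr add0r -scalerBl enormZ.
have g0 : g 0 = x by rewrite /g scale0r addr0.
have g1 : g 1 = y by rewrite /g scale1r addrC subrK.
have yx0 : 0 < enorm (y - x).
  by rewrite enorm_gt0 subr_eq0; apply/eqP => yx; apply: nAy; rewrite yx.
exists (g c); last first.
  have -> : enorm (x - g c) = c * enorm (y - x).
    by rewrite -[X in enorm (X - _)]g0 gB sub0r normrN ger0_norm.
  have -> : enorm (g c - y) = (1 - c) * enorm (y - x).
    by rewrite -[X in enorm (_ - X)]g1 gB distrC ger0_norm ?subr_ge0.
  by rewrite -mulrDl addrC subrK mul1r enormB.
split.
  apply/closure_enormP => e e0; have [t Et ct] := sup_adherent (divr_gt0 e0 yx0) supE.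
  exists (g t); first by case: Et.
  have tc : t <= c by apply: ub_le_sup => //; exists 1.
  rewrite gB ger0_norm ?subr_ge0 // -ltr_pdivlMr //; rewrite -/c in ct; lra.
move/nbhs_enormP => [e e0 gA]; have [c1'|] := ltP c 1; last first.
  move=> c1'; have cE : c = 1 by apply/eqP; rewrite eq_le c1 c1'.
  by apply: nAy; rewrite -g1 -cE; apply: gA; rewrite subrr enorm0.
(* A time beyond the supremum, still on the segment and within [e] of [g c]; were [g c] interior, it
   would belong to [A]. *)
pose t := Num.min 1 (c + e / 2 / enorm (y - x)).
have d0 : 0 < e / 2 / enorm (y - x) by rewrite !divr_gt0.
have ct : c < t by rewrite /t lt_min c1' ltrDl d0.
have t_le : t <= c + e / 2 / enorm (y - x) by rewrite /t ge_min lexx orbT.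
have Et : E t.
  split; first by rewrite (le_trans c0 (ltW ct)) /t ge_min lexx.
  apply: gA; rewrite gB distrC ger0_norm ?subr_ge0 ?(ltW ct) //.
  apply: le_lt_trans (_ : e / 2 < e); last by rewrite ltr_pdivrMr // ltr_pMr // ltr1n.
  by rewrite -ler_pdivlMr //; lra.
by have := ub_le_sup (ex_intro _ 1 E1) Et; rewrite -/c leNgt ct.
Qed.

Lemma dist_le B x y : B y -> dist x B <= enorm (x - y).
Proof.
move=> By; apply: ge_inf; last by exists y.
by exists 0 => _ [z _ <-]; exact: enorm_ge0.
Qed.

Lemma dist_ge B x (c : R) : B !=set0 -> (forall y, B y -> c <= enorm (x - y)) -> c <= dist x B.
Proof.
move=> [y By] cB; apply: lb_le_inf; first by exists (enorm (x - y)), y.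
by move=> _ [z Bz <-]; exact: cB.
Qed.

Lemma dist_ge0 B x : B !=set0 -> 0 <= dist x B.
Proof. by move=> B0; apply: dist_ge => // y _; exact: enorm_ge0. Qed.

Lemma dist_lip B x y : B !=set0 -> dist x B - dist y B <= enorm (x - y).
Proof.
move=> B0; rewrite lerBlDr -lerBlDl; apply: dist_ge => // z Bz; rewrite lerBlDl.
exact: le_trans (dist_le x Bz) (enorm_distD y x z).
Qed.

(** On one side of the boundary this is the bound for [dist]. If [x] is outside and [y] inside, both
    distances are compared with those to a crossing point, and these add up to the length of the
    segment. *)
Lemma sdist_lip A x y : boundary A !=set0 -> sdist A x - sdist A y <= enorm (x - y).
Proof.
move=> A0; have dx := dist_ge0 x A0; have dy := dist_ge0 y A0.
have := dist_lip x y A0; have := dist_lip y x A0; rewrite (enormB y x) /sdist.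
case: ifPn; rewrite ?inE ?notin_setE => Ax; case: ifPn; rewrite ?inE ?notin_setE => Ay.
- by lra.
- by have := enorm_ge0 (x - y); lra.
- have [z Az e] := boundary_crossing Ay Ax.
  by have := dist_le x Az; have := dist_le y Az; rewrite (enormB x z) (enormB x y); lra.
- by lra.
Qed.

Lemma boundary_sub A : closed A -> boundary A `<=` A.
Proof. by move=> cA x [] clAx _; rewrite closure_id in cA; rewrite cA. Qed.

(** The constant [3 * C] is dictated by the points of [A]: there the signed distance is at least
    [- 2 * C] while the norm may reach [C]. Growth at infinity confines the relevant placements to a
    bounded set. *)
Lemma sdist_coercive A (C : R) x : closed A -> boundary A !=set0 ->
  (forall y, A y -> enorm y <= C) -> enorm x - 3 * C <= sdist A x.
Proof.
move=> cA A0 AC; have [z Az] := A0; have zC := AC _ (boundary_sub cA Az).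
have C0 : 0 <= C by exact: le_trans (enorm_ge0 _) zC.
rewrite /sdist; case: ifPn; rewrite ?inE ?notin_setE => Ax.
  have := AC _ Ax; have := dist_le x Az.
  by have := enorm_triangle x (- z); rewrite enormN; lra.
apply: (@le_trans _ _ (enorm x - C)); first by lra.
apply: dist_ge => // y /(boundary_sub cA)/AC yC.
by have := enorm_lerB x y; lra.
Qed.

Lemma compact_enorm_bounded A : compact A -> exists C : R, forall y, A y -> enorm y <= C.
Proof.
move=> /compact_bounded[M [_ MA]]; exists (n%:R * (M + 1)) => y Ay.
apply: le_trans (enorm_le_norm _) _; rewrite ler_wpM2l //.
by apply: MA Ay; rewrite ltrDl.
Qed.

Lemma boundary_nonempty A (C : R) : (0 < n)%N -> A !=set0 ->
  (forall y, A y -> enorm y <= C) -> boundary A !=set0.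
Proof.
move=> n0 [x Ax] AC; pose y : 'rV[R]_n := const_mx (C + 1).
have C0 : 0 <= C by exact: le_trans (enorm_ge0 _) (AC _ Ax).
have nAy : ~ A y.
  move=> /AC; apply/negP; rewrite -ltNge.
  have := enorm_coord y (Ordinal n0); rewrite mxE ger0_norm; lra.
by have [z Az _] := boundary_crossing Ax nAy; exists z.
Qed.

Lemma compact_rV_closed A : compact A -> closed A.
Proof. by apply: compact_closed; exact: norm_hausdorff. Qed.

Lemma closed_enorm_bounded_compact A (C : R) : closed A ->
  (forall y, A y -> enorm y <= C) -> compact A.
Proof.
move=> cA AC; apply: bounded_closed_compact => //.
exists C; split; first by rewrite num_real.
by move=> M CM y /AC yC /=; rewrite (le_trans (norm_le_enorm _)) // (le_trans yC) // ltW.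
Qed.

Lemma sublevel_forest A (r : R) : (0 < n)%N -> forest A -> sublevel A r !=set0 ->
  forest (sublevel A r).
Proof.
move=> n0 [A0 cA] Ar0; split=> //; have [C AC] := compact_enorm_bounded cA.
have bA := boundary_nonempty n0 A0 AC; have clA := compact_rV_closed cA.
apply: (@closed_enorm_bounded_compact _ (r + 3 * C)).
  move=> x /closure_enormP clx; rewrite /sublevel /=; apply/ler_addgt0Pr => e e0.
  have [y yr xy] := clx e e0; have := sdist_lip x y bA; move: yr; rewrite /sublevel /=; lra.
by move=> y; rewrite /sublevel /= => yr; have := sdist_coercive y clA bA AC; lra.
Qed.

(** A point closer to [x] than [r - c] has signed distance below [r] with room to spare, so it is
    interior to the sublevel set and not on its boundary. A strict inequality in [A] thus becomes a
    definite margin in the sublevel set. *)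
Lemma sdist_sublevel_le A (r c : R) x : boundary A !=set0 -> boundary (sublevel A r) !=set0 ->
  c < r -> sdist A x <= c -> sdist (sublevel A r) x <= c - r.
Proof.
move=> bA bAr cr xc; rewrite /sdist mem_set; last by rewrite /sublevel /=; lra.
rewrite lerNl opprB; apply: dist_ge => // z [_ ziA]; rewrite leNgt; apply/negP => xz.
apply: ziA; apply/nbhs_enormP; exists (r - c - enorm (x - z)); first by lra.
move=> y zy; rewrite /sublevel /=; have := sdist_lip z x bA; have := sdist_lip y z bA.
by rewrite (enormB y z) (enormB z x); lra.
Qed.

Lemma sdist_sublevel_ge A (r c : R) x : boundary A !=set0 -> closed (sublevel A r) ->
  boundary (sublevel A r) !=set0 ->
  r < c -> c <= sdist A x -> c - r <= sdist (sublevel A r) x.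
Proof.
move=> bA cAr bAr rc xc; rewrite /sdist memNset; last by rewrite /sublevel /=; lra.
apply: dist_ge => // z /(boundary_sub cAr); rewrite /sublevel /= => zr.
by have := sdist_lip x z bA; lra.
Qed.

End SignedDistance.

(** * Paths *)

Section Paths.
Variables (R : realType) (n : nat).
Implicit Types (f : R -> 'rV[R]_n) (p : nat -> 'rV[R]_n).

Lemma sum_telescope (V : zmodType) (F : nat -> V) N : \sum_(i < N) (F i.+1 - F i) = F N - F 0%N.
Proof. by rewrite -(big_mkord xpredT (fun i => F i.+1 - F i)) telescope_sumr. Qed.

Lemma minrB_mono (a b s t : R) : a <= b -> s <= t ->
  Num.min s b - Num.min s a <= Num.min t b - Num.min t a.
Proof.
move=> ab st; case: (leP s a) => ?; case: (leP s b) => ?;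
  case: (leP t a) => ?; case: (leP t b) => ?; lra.
Qed.

(** Summing clamped edge contributions avoids a case split on the edge containing [t]; the Lipschitz
    bound holds because the time shares of the edges increase and add up to [t - s]. Unequal
    durations serve to run a polygon at nearly constant speed. *)
Lemma polygon_path N p (d : nat -> R) :
  (forall i, (i < N)%N -> 0 < d i) -> \sum_(i < N) d i = 1 ->
  exists2 f,
    forall l : R, (forall i, (i < N)%N -> enorm (p i.+1 - p i) <= l * d i) -> paths l f &
    forall k, (k <= N)%N -> f (\sum_(i < k) d i) = p k.
Proof.
move=> d0 d1; pose T k := \sum_(i < k) d i.
have TS k : T k.+1 = T k + d k by rewrite /T big_ord_recr.
have T_mono i k : (i <= k <= N)%N -> T i <= T k.
  case/andP; elim: k => [|k IHk]; first by rewrite leqn0 => /eqP->.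
  rewrite leq_eqVlt => /predU1P[->//|ik kN].
  by rewrite TS (le_trans (IHk ik (ltnW kN))) // lerDl ltW ?d0.
(* [c i t / d i] is the portion of the edge [i] covered at the time [t]. *)
pose c i t := Num.min t (T i.+1) - Num.min t (T i).
pose f t := p 0%N + \sum_(i < N) (c i t / d i) *: (p i.+1 - p i).
exists f => [l dp s t|k kN].
  wlog st : s t / s <= t.
    move=> wl s01 t01; case: (leP s t) => [/wl|/ltW/wl]; first exact.
    by rewrite enormB distrC; apply.
  move=> /andP[s0 s1] /andP[t0 t1].
  have c_sum u : 0 <= u <= 1 -> \sum_(i < N) c i u = u.
    move=> /andP[u0 u1]; rewrite (sum_telescope (fun i => Num.min u (T i))).
    by rewrite /T d1 big_ord0 min_l // min_r // subr0.
  rewrite enormB /f opprD addrACA subrr add0r -sumrB.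
  apply: le_trans (enorm_sum _ _) _.
  have -> : l * `|s - t| = \sum_(i < N) l * (c i t - c i s).
    rewrite -mulr_sumr sumrB !c_sum ?s0 ?t0 // distrC ger0_norm ?subr_ge0 //.
  apply: ler_sum => i _; rewrite -scalerBl -mulrBl enormZ.
  have cc : 0 <= c i t - c i s by rewrite subr_ge0 minrB_mono ?T_mono // leqnSn ltn_ord.
  have di := d0 i (ltn_ord i).
  rewrite ger0_norm ?divr_ge0 ?(ltW di) // mulrAC ler_pdivrMr // mulrC [leRHS]mulrAC ler_wpM2r //.
  exact: dp.
rewrite /f -/(T k) (bigID (fun i : 'I_N => (i < k)%N)) /= [X in _ + (_ + X)]big1 ?addr0; last first.
  move=> i; rewrite -leqNgt => ki; have ki' : T k <= T i by rewrite T_mono // ki ltnW.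
  by rewrite /c !min_l ?subrr ?mul0r ?scale0r // (le_trans ki') // T_mono // leqnSn ltn_ord.
rewrite -(big_ord_widen N (fun i => (c i (T k) / d i) *: (p i.+1 - p i)) kN).
rewrite (eq_bigr (fun i : 'I_k => p i.+1 - p i)).
  by rewrite sum_telescope addrC subrK.
move=> i _; have iN := leq_trans (ltn_ord i) kN.
rewrite /c !min_r ?T_mono ?kN ?(ltnW (ltn_ord i)) ?ltn_ord // TS.
by rewrite addrAC subrr add0r divff ?scale1r // gt_eqF ?d0.
Qed.

Lemma uniform_polygon N p : (0 < N)%N -> exists2 f,
    forall l : R, (forall i, (i < N)%N -> enorm (p i.+1 - p i) <= l / N%:R) -> paths l f &
    forall k, (k <= N)%N -> f (k%:R / N%:R) = p k.
Proof.
move=> N0; have sumE k : \sum_(i < k) N%:R^-1 = k%:R / N%:R :> R.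
  by rewrite sumr_const card_ord mulr_natl.
have [||f fl fp] := @polygon_path N p (fun=> N%:R^-1).
- by move=> i _; rewrite invr_gt0 ltr0n.
- by rewrite sumE divff // pnatr_eq0 -lt0n.
by exists f => // k kN; rewrite -sumE fp.
Qed.

Lemma node01 N i : (0 < N)%N -> (i <= N)%N -> 0 <= (i%:R / N%:R : R) <= 1.
Proof.
move=> N0 iN; apply/andP; split; first exact: divr_ge0.
by rewrite ler_pdivrMr ?ltr0n // mul1r ler_nat.
Qed.

Lemma nearest_node N (t : R) : (0 < N)%N -> 0 <= t <= 1 ->
  exists2 i, (i <= N)%N & 0 <= t - i%:R / N%:R <= N%:R^-1.
Proof.
move=> N0 /andP[t0 t1]; have N0' : 0 < N%:R :> R by rewrite ltr0n.
have tN : 0 <= t * N%:R by rewrite mulr_ge0.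
have /andP[lo hi] := truncn_itv tN; rewrite -natr1 in hi.
exists (Num.truncn (t * N%:R)).
  by rewrite -(ler_nat R) (le_trans lo) // ler_piMl // ltW.
have -> : t - (Num.truncn (t * N%:R))%:R / N%:R = (t * N%:R - (Num.truncn (t * N%:R))%:R) / N%:R.
  by rewrite mulrBl mulfK ?gt_eqF.
rewrite divr_ge0 ?subr_ge0 // ?(ltW N0') //= ler_piMl ?invr_ge0 ?(ltW N0') //; lra.
Qed.

(** * Compactness of paths *)

Let curves := prod_topology (fun _ : R => 'rV[R]_n).

Lemma nbhs_finite_times (g : curves) (ts : seq R) (e : R) : 0 < e ->
  nbhs g [set h : curves | {in ts, forall t, enorm (h t - g t) < e}].
Proof.
have nbhs_g : Filter (nbhs g) := nbhs_filter g.
move=> e0; elim: ts => [|t ts IHts]; first by apply: filterS filterT => h _ u; rewrite in_nil.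
have nbt : nbhs g (@proj R (fun=> 'rV[R]_n) t @^-1` [set x | enorm (g t - x) < e]).
  exact: (@proj_continuous R (fun=> 'rV[R]_n) t g _ (nbhs_enorm_ball (g t) e0)).
apply: filterS (filterI nbt IHts) => h [ht hts] u.
by rewrite inE => /predU1P[->|]; [rewrite enormB|exact: hts].
Qed.

(** A form of the Arzela-Ascoli theorem: Tychonoff gives a pointwise cluster point, and the common
    Lipschitz constant upgrades closeness at finitely many times to uniform closeness. *)
Lemma paths_cluster (C : R) (f_ : nat -> R -> 'rV[R]_n) : 0 <= C ->
  (forall k, paths C (f_ k)) -> (forall k, f_ k 0 = 0) ->
  exists f, [/\ paths C f, f 0 = 0 & forall e : R, 0 < e -> forall k0, exists2 k, (k0 <= k)%N &
    forall t, 0 <= t <= 1 -> enorm (f_ k t - f t) <= e].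
Proof.
(* Nothing is known of the paths outside [[0, 1]]; clamping the time puts them into a compact
   product of cubes. *)
move=> C0 f_C f_0; pose clamp (t : R) := Num.max 0 (Num.min 1 t).
have clamp01 t : 0 <= clamp t <= 1.
  by rewrite /clamp le_max ge_max ge_min !lexx ler01.
have clampE t : 0 <= t <= 1 -> clamp t = t.
  by move=> /andP[t0 t1]; rewrite /clamp (min_r t1) (max_r t0).
pose g k : curves := fun t => f_ k (clamp t).
pose cube := [set v : 'rV[R]_n | forall i, `[-C, C]%classic (v ord0 i)].
have cube_compact : compact cube.
  exact: (@rV_compact R n (fun=> `[-C, C]%classic) (fun=> @segment_compact R (-C) C)).
pose box : set curves := [set h | forall t, cube (h t)].
have box_compact : compact box.
  exact: (@tychonoff R (fun=> 'rV[R]_n) (fun=> cube) (fun=> cube_compact)).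
have g_box k : box (g k).
  move=> t i /=; rewrite in_itv /= -ler_norml; apply: le_trans (enorm_coord _ _) _.
  have /andP[c0 c1] := clamp01 t.
  have := f_C k (clamp t) 0 (clamp01 t); rewrite lexx ler01 f_0 !subr0 => /(_ isT) h.
  by apply: le_trans h _; rewrite ger0_norm // ler_piMr.
have [|h [h_box h_cluster]] := box_compact (g @ \oo) _.
  by exists 0%N => // k _; exact: g_box.
have near_h (ts : seq R) (e : R) k0 : 0 < e ->
    exists2 k, (k0 <= k)%N & {in ts, forall t, enorm (g k t - h t) < e}.
  move=> e0; have [|_ [/= [k k0k <-] hk]] :=
    h_cluster (g @` [set k | (k0 <= k)%N]) _ _ (nbhs_finite_times h ts e0).
    by exists k0 => // k k0k; exists k.
  by exists k.
have h_lip : paths C h.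
  move=> s t s01 t01; apply/ler_addgt0Pr => e e0.
  have [k _ hk] := near_h [:: s; t] (e / 2) 0%N (divr_gt0 e0 (ltr0n _ 2)).
  have hs := hk s (mem_head _ _).
  have ht : enorm (g k t - h t) < e / 2 by apply: hk; rewrite !inE eqxx orbT.
  have := f_C k s t s01 t01; have := enorm_distD (g k s) (h s) (h t).
  have := enorm_distD (g k t) (g k s) (h t); rewrite (enormB (h s) (g k s)) /g !clampE //.
  by move: hs ht; rewrite /g !clampE //; lra.
have h0 : h 0 = 0.
  apply/eqP; rewrite -enorm_eq0 eq_le enorm_ge0 andbT; apply/ler_addgt0Pr => e e0.
  have [k _ hk] := near_h [:: 0] e 0%N e0; have := hk 0 (mem_head _ _).
  by rewrite /g clampE ?lexx ?ler01 // f_0 enormB subr0 add0r => /ltW.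
exists h; split => // e e0 k0.
pose N := (Num.truncn (3 * C / e)).+1.
have N0 : 0 < N%:R :> R by rewrite ltr0n.
have CN : C / N%:R <= e / 3.
  have C3 : 0 <= 3 * C / e by rewrite divr_ge0 ?mulr_ge0 // ltW.
  have /andP[_ hN] := truncn_itv C3; rewrite -/N in hN.
  rewrite ler_pdivrMr //; move: hN; rewrite ltr_pdivrMr // => hN; lra.
have [k k0k hk] := near_h [seq i%:R / N%:R | i <- iota 0 N.+1] (e / 3) k0 (divr_gt0 e0 (ltr0n _ 3)).
exists k => // t t01; have [i iN /andP[ti0 tiN]] := @nearest_node N t (ltn0Sn _) t01.
have i01 := @node01 N i (ltn0Sn _) iN.
have : enorm (g k (i%:R / N%:R) - h (i%:R / N%:R)) < e / 3.
  by apply: hk; apply/mapP; exists i => //; rewrite mem_iota.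
rewrite /g clampE // => hi.
have lip_le (u : R -> 'rV[R]_n) : paths C u -> enorm (u t - u (i%:R / N%:R)) <= e / 3.
  move=> uC; apply: le_trans (uC _ _ t01 i01) _; rewrite ger0_norm //.
  by apply: le_trans CN; rewrite ler_wpM2l.
have := lip_le _ (f_C k); have := lip_le _ h_lip.
have := enorm_distD (f_ k (i%:R / N%:R)) (f_ k t) (h t).
have := enorm_distD (h (i%:R / N%:R)) (f_ k (i%:R / N%:R)) (h t).
by rewrite (enormB (h (i%:R / N%:R)) (h t)); lra.
Qed.

(** * Arc length *)

Lemma polygon_length_le f (l a : R) s : paths l f -> 0 <= a -> path <%O a s -> last a s <= 1 ->
  \sum_(i < size s) enorm (f (nth 0 s i) - f (nth 0 (a :: s) i)) <= l * (last a s - a).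
Proof.
move=> fl; elim: s a => [|b s IHs] a a0 /=; first by rewrite big_ord0 subrr mulr0.
case/andP=> ab bs s1; rewrite big_ord_recl /=.
have b1 : b <= 1 by apply: le_trans s1; apply: itv_partition_le (conj bs (eqxx _)).
have := IHs b (le_trans a0 (ltW ab)) bs s1.
have := fl b a; rewrite a0 b1 (le_trans a0 (ltW ab)) (le_trans (ltW ab) b1) => /(_ isT isT).
by rewrite gtr0_norm ?subr_gt0 //; lra.
Qed.

Lemma arc_length_le f (l : R) : paths l f -> arc_length f <= l.
Proof.
move=> fl; apply: ge_sup.
  by exists (polygon_length f [:: 1]), [:: 1] => //; exact: itv_partition1.
move=> _ [s [s_path /eqP s1] <-].
by have := polygon_length_le fl (lexx 0) s_path; rewrite s1 subr0 mulr1; apply.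
Qed.

Lemma arc_length_ge f (l : R) N : paths l f -> (0 < N)%N ->
  \sum_(i < N) enorm (f (i.+1%:R / N%:R) - f (i%:R / N%:R)) <= arc_length f.
Proof.
move=> fl N0; have N0' : 0 < N%:R :> R by rewrite ltr0n.
apply: ub_le_sup.
  exists l => _ [s [s_path /eqP s1] <-].
  by have := polygon_length_le fl (lexx 0) s_path; rewrite s1 subr0 mulr1; apply.
exists (mkseq (fun i => i.+1%:R / N%:R) N).
  split; last first.
    rewrite (last_nth 0) size_mkseq; case: (N) N0 => // m _.
    by rewrite /= nth_mkseq // divff ?pnatr_eq0.
  apply/(pathP 0) => i; rewrite size_mkseq => iN; rewrite nth_mkseq //.
  case: i iN => [|i] iN; first by rewrite divr_gt0 ?ltr0n.
  by rewrite /= nth_mkseq 1?ltnW // ltr_pM2r ?invr_gt0 // ltr_nat.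
rewrite /polygon_length size_mkseq; apply: eq_bigr => -[i iN] _ /=; rewrite nth_mkseq //.
by case: i iN => [|i] iN; rewrite ?mul0r //= nth_mkseq // ltnW.
Qed.

End Paths.

(** * Escaping *)

Section Escape.
Variables (R : realType) (n : nat).
Implicit Types (A B : set 'rV[R]_n) (f g : R -> 'rV[R]_n) (sigma : 'rV[R]_n -> 'rV[R]_n).

Lemma ex_mid (a b : R) : a < b -> exists2 c, a < c & c < b.
Proof. by move=> ab; exists ((a + b) / 2); lra. Qed.

(** The properties of the signed distance on which the compactness and approximation arguments
    rest. *)
Definition tame B := (forall x y, sdist B x - sdist B y <= enorm (x - y)) /\
  exists K : R, forall x, enorm x - K <= sdist B x.

(** [fits] and [escapes] stand for [wcc B f <= c] and [c <= wcc B f]. Up to an arbitrarily small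
    change of [c] they are equivalent to these, so no infimum has to be shown to be attained. *)
Definition fits B (c : R) f := exists2 sigma, isom_plus sigma &
  forall t, 0 <= t <= 1 -> sdist B (sigma (f t)) <= c.

Definition escapes B (c : R) f := forall sigma, isom_plus sigma ->
  exists2 t, 0 <= t <= 1 & c <= sdist B (sigma (f t)).

Lemma isom_plus_id : isom_plus (id : 'rV[R]_n -> 'rV[R]_n).
Proof.
by split=> //; exists 1%:M, 0; rewrite det1 ltr01; split=> // x; rewrite mulmx1 addr0.
Qed.

Lemma isom_plus_translate sigma v : isom_plus sigma -> isom_plus (fun x => sigma (x + v)).
Proof.
move=> [iso [M [w [dM sE]]]]; split=> [x y|]; first by rewrite iso opprD addrACA subrr addr0.
by exists M, (v *m M + w); split=> // x; rewrite sE mulmxDl addrA.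
Qed.

Lemma le_paths (l l' : R) f : l <= l' -> paths l f -> paths l' f.
Proof. by move=> ll fl s t s01 t01; apply: le_trans (fl s t s01 t01) _; rewrite ler_wpM2r. Qed.

Lemma paths_isom (l : R) f sigma : isom_plus sigma -> paths l f -> paths l (sigma \o f).
Proof. by move=> [iso _] fl s t s01 t01; rewrite /= iso; exact: fl. Qed.

Lemma paths_near0 (l : R) f t : 0 <= l -> paths l f -> 0 <= t <= 1 -> enorm (f t - f 0) <= l.
Proof.
move=> l0 fl t01; apply: le_trans (fl t 0 t01 _) _; first by rewrite lexx ler01.
by move: t01 => /andP[t0 t1]; rewrite subr0 ger0_norm // ler_piMr.
Qed.

Lemma paths_ge0 (l : R) f : paths l f -> 0 <= l.
Proof.
move=> fl; have := fl 1 0; rewrite lexx ler01 lexx => /(_ isT isT).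
by rewrite subr0 normr1 mulr1; apply: le_trans; exact: enorm_ge0.
Qed.

Lemma paths_const (l : R) (v : 'rV[R]_n) : 0 <= l -> paths l (fun=> v).
Proof. by move=> l0 s t _ _; rewrite subrr enorm0 mulr_ge0. Qed.

Lemma fits_escapes B (c c' : R) f : c < c' -> fits B c f -> escapes B c' f -> False.
Proof. by move=> cc [s iso sf] /(_ s iso)[t /sf h1 h2]; lra. Qed.

Lemma escapes_translate B (c : R) f v : escapes B c f -> escapes B c (fun t => f t - v).
Proof. by move=> ef sigma /(isom_plus_translate (- v))/ef. Qed.

Section Tame.
Variable B : set 'rV[R]_n.
Hypothesis tB : tame B.
Let d := sdist B.

Lemma con_ub (l : R) f t : paths l f -> 0 <= t <= 1 -> d (f t) <= con B f.
Proof.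
move=> fl t01; apply: ub_le_sup; last by exists t.
exists (d (f 0) + l) => _ [u + <-]; rewrite /= in_itv /= => u01.
have := tB.1 (f u) (f 0); have := paths_near0 (paths_ge0 fl) fl u01.
by rewrite /d; lra.
Qed.

Lemma con_le (c : R) f : (forall t, 0 <= t <= 1 -> d (f t) <= c) -> con B f <= c.
Proof.
move=> fc; apply: ge_sup; first by exists (d (f 0)), 0 => //; rewrite /= in_itv /= lexx ler01.
by move=> _ [u + <-]; rewrite /= in_itv /=; exact: fc.
Qed.

Lemma has_lb_cons (l : R) f : paths l f ->
  has_lbound [set con B (sigma \o f) | sigma in (@isom_plus R n)].
Proof.
move=> fl; have [_ [K dK]] := tB; exists (- K) => _ [sigma iso <-].
have h01 : 0 <= (0 : R) <= 1 by rewrite lexx ler01.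
apply: le_trans (con_ub (paths_isom iso fl) h01) => /=.
by have := dK (sigma (f 0)); have := enorm_ge0 (sigma (f 0)); rewrite /d; lra.
Qed.

Lemma wcc_fits (l c : R) f : paths l f -> wcc B f < c -> fits B c f.
Proof.
move=> fl; rewrite /wcc => /inf_lt[|_ [sigma iso <-] con_c].
  by exists (con B (id \o f)), id => //; exact: isom_plus_id.
exists sigma => // t t01; apply/ltW/(le_lt_trans _ con_c).
exact: con_ub (paths_isom iso fl) t01.
Qed.

Lemma fits_wcc (l c : R) f : paths l f -> fits B c f -> wcc B f <= c.
Proof.
move=> fl [sigma iso sf]; apply: le_trans (con_le sf).
by apply: ge_inf; [exact: has_lb_cons fl|exists sigma].
Qed.

Lemma escapes_wcc (l c : R) f : paths l f -> escapes B c f -> c <= wcc B f.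
Proof.
move=> fl ef; rewrite leNgt; apply/negP => /(@midf_lt _)[wm mc].
exact: fits_escapes mc (wcc_fits fl wm) ef.
Qed.

Lemma wcc_escapes (l c : R) f : paths l f -> c < wcc B f -> escapes B c f.
Proof.
move=> fl cw sigma iso; apply: contrapT => nex; move: cw; apply/negP; rewrite -leNgt.
apply: (fits_wcc fl); exists sigma => // t t01; rewrite leNgt; apply/negP => ct.
by apply: nex; exists t => //; exact: ltW.
Qed.

Lemma has_ub_wcc (l : R) : has_ubound [set wcc B f | f in @paths R n l].
Proof.
exists (d 0 + l) => _ [f fl <-]; apply: (fits_wcc fl).
exists (fun x => x - f 0); first exact: isom_plus_translate isom_plus_id.
move=> t t01; have := paths_near0 (paths_ge0 fl) fl t01.
by have := tB.1 (f t - f 0) 0; rewrite subr0 /d; lra.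
Qed.

Lemma wcc_le_esc (l : R) f : paths l f -> wcc B f <= esc B l.
Proof. by move=> fl; apply: ub_le_sup; [exact: has_ub_wcc|exists f]. Qed.

Lemma esc_fits (l c : R) f : esc B l < c -> paths l f -> fits B c f.
Proof. by move=> ec fl; apply: (wcc_fits fl); exact: le_lt_trans (wcc_le_esc fl) ec. Qed.

Lemma fits_esc (l c : R) : 0 <= l -> (forall f, paths l f -> fits B c f) -> esc B l <= c.
Proof.
move=> l0 fc; apply: ge_sup.
  by exists (wcc B (fun=> 0)), (fun=> 0) => //; exact: paths_const.
by move=> _ [f fl <-]; exact: fits_wcc fl (fc f fl).
Qed.

Lemma esc_escapes (l c : R) : 0 <= l -> c < esc B l -> exists2 f, paths l f & escapes B c f.
Proof.
move=> l0 /sup_gt[|_ [f fl <-] cf]; last by exists f => //; exact: wcc_escapes fl cf.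
by exists (wcc B (fun=> 0)), (fun=> 0) => //; exact: paths_const.
Qed.

(** A straight segment that fits with nonpositive signed distance has both ends within [K] of the
    origin, so its length is at most [K + K]. This bounds the set whose supremum is [L1]. *)
Lemma bounded_fitting : (0 < n)%N -> exists C : R, forall l, 0 <= l -> esc B l < 0 -> l <= C.
Proof.
move=> n0; have [_ [K dK]] := tB; exists (K + K) => l l0 el.
pose e : 'rV[R]_n := delta_mx 0 (Ordinal n0).
have e1 : enorm e = 1 by rewrite enormE dot_delta eqxx sqrtr1.
pose f (t : R) := (l * t) *: e.
have fB s t : enorm (f s - f t) = l * `|s - t|.
  by rewrite -scalerBl -mulrBr enormZ e1 mulr1 normrM ger0_norm.
have [|sigma [iso _] sf] := esc_fits el (f := f); first by move=> s t _ _; rewrite fB.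
have h01 : 0 <= (0 : R) <= 1 by rewrite lexx ler01.
have h11 : 0 <= (1 : R) <= 1 by rewrite lexx ler01.
have := sf 0 h01; have := sf 1 h11; have := dK (sigma (f 0)); have := dK (sigma (f 1)).
have := enorm_triangle (sigma (f 1)) (- sigma (f 0)).
by rewrite enormN iso fB subr0 normr1 mulr1; lra.
Qed.

End Tame.

(** Below [L] the margin is uniform over all paths of the given speed; above [L] a single path with
    a positive margin suffices as a certificate. *)
Definition sharp B (L : R) := [/\ tame B, 0 < L,
  forall l, 0 <= l -> l < L -> exists2 e : R, 0 < e & forall f, paths l f -> fits B (- e) f &
  forall l, L < l -> exists f, exists2 c : R, 0 < c & paths l f /\ escapes B c f].

Lemma sublevel_sharp A (r : R) : (0 < n)%N -> forest A -> min_esc A < r ->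
  (forall q : rat, esc A (ratr q) != r) -> sharp (sublevel A r) (L1 (sublevel A r)).
Proof.
move=> n0 fA rA rq; have [A0 cA] := fA; set B := sublevel A r.
have [C AC] := compact_enorm_bounded cA; have clA := compact_rV_closed cA.
have bA := boundary_nonempty n0 A0 AC.
have tA : tame A.
  by split=> [x y|]; [exact: sdist_lip|exists (3 * C) => x; exact: sdist_coercive].
have [l0 l00 l0r] : exists2 l0 : R, 0 <= l0 & esc A l0 < r.
  have [|_ [l l0 <-]] := inf_lt _ rA; last by exists l.
  by exists (esc A 0), 0 => //=.
have [c c1 c2] := ex_mid l0r.
have constP (v : 'rV[R]_n) := esc_fits tA c1 (paths_const v l00).
have B0 : B !=set0.
  have [sigma _ sc] := constP 0; exists (sigma 0); rewrite /B /sublevel /=.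
  by have := sc 0; rewrite lexx ler01 => /(_ isT); lra.
have [_ cB] : forest B by exact: sublevel_forest.
have [CB BC] := compact_enorm_bounded cB; have clB := compact_rV_closed cB.
have bB := boundary_nonempty n0 B0 BC.
have tB : tame B.
  by split=> [x y|]; [exact: sdist_lip|exists (3 * CB) => x; exact: sdist_coercive].
have fitsAB e f : e < r -> fits A e f -> fits B (e - r) f.
  by move=> er [s iso sf]; exists s => // t t01; apply: sdist_sublevel_le (sf t t01).
have escapesAB e f : r < e -> escapes A e f -> escapes B (e - r) f.
  move=> er ef s iso; have [t t01 et] := ef s iso; exists t => //.
  exact: sdist_sublevel_ge.
have [M MB] := bounded_fitting tB n0.
have ubL : has_ubound [set l : R | 0 <= l /\ esc B l < 0].
  by exists M => l [l_ge0 el]; exact: MB.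
(* A constant path can be placed at level [c], and a path of speed [l1] stays within [l1] of its
   start, hence at level [c + l1 < r]. This makes [L1 B] positive. *)
pose l1 := (r - c) / 2; have l1_gt0 : 0 < l1 by rewrite /l1; lra.
have el1 : esc B l1 < 0.
  apply: le_lt_trans (_ : c + l1 - r < 0); last by rewrite /l1; lra.
  apply: (fits_esc tB (ltW l1_gt0)) => f fl; apply: fitsAB; first by rewrite /l1; lra.
  have [s iso sc] := constP (f 0); exists s => // t t01.
  have := sc t t01; have := tA.1 (s (f t)) (s (f 0)); rewrite iso.1.
  by have := paths_near0 (ltW l1_gt0) fl t01; lra.
have L_gt0 : 0 < L1 B.
  exact: lt_le_trans l1_gt0 (ub_le_sup ubL (conj (ltW l1_gt0) el1)).
split=> // [l l_ge0|l].
- have supL : has_sup [set l : R | 0 <= l /\ esc B l < 0].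
    by split=> //; exists l1; exact: (conj (ltW l1_gt0) el1).
  move=> /(sup_gt supL.1)[l' [l'0 el'] ll'].
  have [z ez z0] := ex_mid el'; exists (- z); first by rewrite oppr_gt0.
  by move=> f fl; rewrite opprK; exact: (esc_fits tB ez (le_paths (ltW ll') fl)).
move=> Ll; have [q] := rat_in_itvoo Ll; rewrite in_itv /= => /andP[Lq ql].
have q0 : 0 <= ratr q :> R.
  exact: ltW (lt_trans L_gt0 Lq).
have eBq : 0 <= esc B (ratr q).
  rewrite leNgt; apply/negP => eq; move: Lq; apply/negP; rewrite -leNgt.
  exact: (ub_le_sup ubL (conj q0 eq)).
(* The only use of the genericity of [r]: [esc A (ratr q) < r] would make [esc B (ratr q)] negative,
   and equality is excluded by [rq]. *)
have rAq : r < esc A (ratr q).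
  rewrite lt_neqAle eq_sym rq /= leNgt; apply/negP => eq.
  have [z ez zr] := ex_mid eq.
  have h := fits_esc tB q0 (fun f fl => fitsAB z f zr (esc_fits tA ez fl)).
  by move: eBq; rewrite leNgt (le_lt_trans h) // subr_lt0.
have [z rz ze] := ex_mid rAq; have [f fl ef] := esc_escapes tA q0 ze.
exists f, (z - r); first by rewrite subr_gt0.
by split; [exact: le_paths (ltW ql) fl|exact: escapesAB].
Qed.

(** These conditions are closed, hence survive uniform limits; that the length is exactly [L] and
    [wcc] exactly zero then follows from sharpness. *)
Definition solution B (L : R) f :=
  [/\ paths L f, f 0 = 0 & forall e : R, 0 < e -> escapes B (- e) f].

Lemma solution_forest B f : sharp B (L1 B) -> solution B (L1 B) f -> forest_solution B f.
Proof.
set L := L1 B => -[tB L0 fit _] [fL f0 ef]; split=> //; last first.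
  apply/eqP; rewrite eq_le; apply/andP; split; apply/ler_addgt0Pr => e e0.
    (* As [f] starts at the origin and has norm at most [L], scaling it down to speed [L - m] moves
       each point by at most [m <= e], and the scaled path fits. *)
    rewrite add0r; pose m := Num.min e L; pose l := L - m.
    have m0 : 0 < m by rewrite /m lt_min e0 L0.
    have me : m <= e by rewrite /m ge_min lexx.
    have mL : m <= L by rewrite /m ge_min lexx orbT.
    have l0 : 0 <= l by rewrite /l; lra.
    have [|e' e'0 fit_l] := fit l l0; first by rewrite /l; lra.
    have [|s iso sf] := fit_l (fun t => (l / L) *: f t).
      move=> s t s01 t01; rewrite -scalerBr enormZ ger0_norm ?divr_ge0 ?(ltW L0) //.
      apply: le_trans (_ : l / L * (L * `|s - t|) <= _).
        by rewrite ler_wpM2l ?divr_ge0 ?(ltW L0) //; exact: fL.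
      by rewrite mulrA divfK ?gt_eqF.
    apply: (fits_wcc tB fL); exists s => // t t01.
    have hm : enorm (f t - (l / L) *: f t) <= m.
      have -> : f t - (l / L) *: f t = (m / L) *: f t.
        rewrite -[X in X - _]scale1r -scalerBl; congr (_ *: _).
        by rewrite /l mulrBl divff ?gt_eqF // opprB addrC subrK.
      have := paths_near0 (ltW L0) fL t01; rewrite f0 subr0 => h.
      rewrite enormZ ger0_norm; last by rewrite divr_ge0 ?ltW.
      by rewrite -mulrA ler_piMr ?(ltW m0) // mulrC ler_pdivrMr // mul1r.
    have := sf t t01; have := tB.1 (s (f t)) (s ((l / L) *: f t)); rewrite iso.1.
    by move: hm me e'0; clear; lra.
  by rewrite -lerBlDr sub0r; exact: (escapes_wcc tB fL (ef e e0)).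
(* Otherwise the polygon through the points [f (i / N)], run with constant speed up
   to [m / N] per edge, is a path of [paths l] with [l < L], hence it fits with a
   margin [e], and so does [f] as soon as [L / N] is smaller than this margin. *)
apply/eqP; rewrite eq_le arc_length_le //= leNgt; apply/negP; rewrite -/L => aL.
pose l := (arc_length f + L) / 2.
have a0 : 0 <= arc_length f.
  by apply: le_trans (arc_length_ge fL (ltn0Sn 0)); rewrite sumr_ge0 // => i _; exact: enorm_ge0.
have l0 : 0 < l by rewrite /l; lra.
have lL : l < L by rewrite /l; lra.
have [e e0 fit_l] := fit l (ltW l0) lL.
pose N := (Num.truncn (2 * L / e)).+1.
have N0 : 0 < N%:R :> R by rewrite ltr0n.
have LN : L / N%:R <= e / 2.
  have L2 : 0 <= 2 * L / e by rewrite divr_ge0 ?mulr_ge0 // ltW.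
  have /andP[_ hN] := truncn_itv L2; rewrite -/N in hN.
  by rewrite ler_pdivrMr //; move: hN; rewrite ltr_pdivrMr // => hN; lra.
pose a (i : nat) := enorm (f (i.+1%:R / N%:R) - f (i%:R / N%:R)).
(* The length left over is spread evenly over the edges, so that even a degenerate edge has a
   positive duration. *)
pose m := l - \sum_(i < N) a i.
have m0 : 0 < m.
  by have := arc_length_ge fL (ltn0Sn _ : (0 < N)%N); rewrite /m /l -/(\sum_(i < N) a i); lra.
have a_ge0 i : 0 <= a i by exact: enorm_ge0.
have sum_d : \sum_(i < N) (a i + m / N%:R) / l = 1.
  rewrite -mulr_suml big_split /= sumr_const card_ord -(mulr_natr (m / N%:R)) divfK ?gt_eqF //.
  by rewrite /m addrC subrK divff ?gt_eqF.
have [||g gl gf] := @polygon_path R n N (fun i => f (i%:R / N%:R)) (fun i => (a i + m / N%:R) / l).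
- by move=> i _; rewrite divr_gt0 // ltr_wpDl // divr_gt0.
- exact: sum_d.
have {}gl : paths l g.
  by apply: gl => i _; rewrite [leRHS]mulrC divfK ?gt_eqF // lerDl divr_ge0 // ltW.
have [s iso sg] := fit_l g gl.
have sf i : (i <= N)%N -> sdist B (s (f (i%:R / N%:R))) <= - e.
  move=> iN; rewrite -(gf i iN); apply: sg.
  have d_ge0 j : 0 <= (a j + m / N%:R) / l.
    by rewrite divr_ge0 ?(ltW l0) // addr_ge0 // divr_ge0 // ltW.
  apply/andP; split; first exact: sumr_ge0.
  rewrite -[leRHS]sum_d [leRHS](bigID (fun j : 'I_N => (j < i)%N)) /=.
  rewrite -(big_ord_widen N (fun j => (a j + m / N%:R) / l) iN) lerDl; exact: sumr_ge0.
(* At the nodes the signed distance is at most [- e], hence at most [- e / 2] everywhere, which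
   contradicts escaping at level [- e / 4]. *)
have [|t t01 et] := ef (e / 4) _ s iso; first by rewrite divr_gt0.
have [i iN /andP[ti0 tiN]] := @nearest_node R N t (ltn0Sn _) t01.
have := fL t (i%:R / N%:R) t01 (@node01 R N i (ltn0Sn _) iN); rewrite ger0_norm // => h1.
have h2 : L * (t - i%:R / N%:R) <= L / N%:R by rewrite ler_wpM2l // ltW.
have := tB.1 (s (f t)) (s (f (i%:R / N%:R))); rewrite iso.1; have := sf i iN.
by lra.
Qed.

Lemma escapes_near B (c e : R) f g : tame B -> escapes B c g ->
  (forall t, 0 <= t <= 1 -> enorm (g t - f t) <= e) -> escapes B (c - e) f.
Proof.
move=> tB eg gf s iso; have [t t01 ct] := eg s iso; exists t => //.
by have := tB.1 (s (g t)) (s (f t)); rewrite iso.1; have := gf t t01; lra.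
Qed.

Lemma limit_solution B (L : R) (f_ : nat -> R -> 'rV[R]_n) f : tame B ->
  (forall l, L < l -> exists k0, forall k, (k0 <= k)%N -> paths l (f_ k)) ->
  (forall e : R, 0 < e -> exists k0, forall k, (k0 <= k)%N -> escapes B (- e) (f_ k)) ->
  (forall e : R, 0 < e -> forall k0, exists2 k, (k0 <= k)%N &
    forall t, 0 <= t <= 1 -> enorm (f_ k t - f t) <= e) ->
  f 0 = 0 -> solution B L f.
Proof.
move=> tB f_L f_e near_f f0; split=> // [s t s01 t01|e e0].
  apply/ler_addgt0Pr => e e0.
  have [|k0 k0P] := f_L (L + e / 3); first by rewrite ltrDl divr_gt0.
  have [|k k0k kf] := near_f (e / 3) _ k0; first by rewrite divr_gt0.
  have := k0P k k0k s t s01 t01; rewrite mulrDl.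
  have st1 : `|s - t| <= 1.
    by rewrite ler_norml; move: s01 t01 => /andP[? ?] /andP[? ?]; apply/andP; split; lra.
  have : e / 3 * `|s - t| <= e / 3 by rewrite ler_piMr // ltW ?divr_gt0.
  have := kf s s01; have := kf t t01.
  have := enorm_distD (f_ k s) (f s) (f t); have := enorm_distD (f_ k t) (f_ k s) (f t).
  by rewrite (enormB (f s) (f_ k s)); lra.
have [|k0 k0P] := f_e (e / 2); first by rewrite divr_gt0.
have [|k k0k kf] := near_f (e / 2) _ k0; first by rewrite divr_gt0.
by have := escapes_near tB (k0P k k0k) kf; rewrite (_ : - (e / 2) - e / 2 = - e); last lra.
Qed.

(** Paths with a positive margin exist at every speed above [L]; moved to the origin, they cluster
    as the speed decreases to [L]. *)
Lemma solution_exists B (L : R) : sharp B L -> exists f, solution B L f.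
Proof.
move=> [tB L0 _ exc].
have ex k : exists f,
    [/\ paths (L + k.+1%:R^-1) f, f 0 = 0 & forall e : R, 0 < e -> escapes B (- e) f].
  have [|f [c c0 [fl ef]]] := exc (L + k.+1%:R^-1); first by rewrite ltrDl invr_gt0 ltr0n.
  exists (fun t => f t - f 0); split=> [s t s01 t01||e e0]; last 1 first.
  - move=> s iso; have [t t01 ct] := @escapes_translate B c f (f 0) ef s iso.
    by exists t => //; apply: le_trans ct; lra.
  - by rewrite opprB addrA subrK; exact: fl.
  - by rewrite subrr.
have [f_ f_P] := choice ex.
have C0 : 0 <= L + 1 by lra.
have [k|k|f [fC f0 near_f]] := @paths_cluster R n (L + 1) f_ C0.
- have [fl _ _] := f_P k; apply: le_paths fl; rewrite lerD2l invf_le1 ?ler1n ?ltr0n //.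
- by have [] := f_P k.
exists f; apply: (limit_solution tB _ _ near_f f0) => [l Ll|e e0].
  exists (Num.truncn (l - L)^-1) => k kl; have [fl _ _] := f_P k; apply: le_paths fl.
  have lL : 0 < l - L by rewrite subr_gt0.
  have inv0 : 0 <= (l - L)^-1 by rewrite invr_ge0 ltW.
  have /andP[_ h] := truncn_itv inv0.
  rewrite -lerBrDl -[leRHS]invrK lef_pV2 ?posrE ?invr_gt0 ?ltr0n //.
  by apply: le_trans (ltW h) _; rewrite ler_nat ltnS.
by exists 0%N => k _; have [_ _] := f_P k; exact.
Qed.

End Escape.

(** * Values of codes *)

Section CodeValues.
Variables (R : realType).

Definition rval (m : nat) : R := ratr (rat_of_nat m).

Lemma rvalE m : rval m = ((qpos m)%:R - (qneg m)%:R) / (qden m)%:R.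
Proof.
rewrite /rval /rat_of_nat rmorphM /= fmorphV /= ratr_nat ratr_int.
congr (_ / _); rewrite /int_of_nat /qpos /qneg; case: ifP => _.
  by rewrite NegzE mulrNz sub0r.
by rewrite subr0.
Qed.

Lemma qden_gt0 m : 0 < (qden m)%:R :> R. Proof. by rewrite ltr0n. Qed.

Lemma rval_qfrac a b d : (0 < d)%N -> rval (qfrac a b d) = (a%:R - b%:R) / d%:R.
Proof.
move=> d0; rewrite /rval /rat_of_nat /qfrac fst_pair_nat snd_pair_nat prednK //.
rewrite rmorphM /= fmorphV /= ratr_nat ratr_int; congr (_ / _).
rewrite /int_of_nat; case: leqP => ab.
  by rewrite addnn odd_double doubleK -natrB.
rewrite /= addnn odd_double /= uphalf_double NegzE mulrNz.
have -> : a%:R - b%:R = - ((b - a.+1).+1)%:R :> R; last by [].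
by rewrite -opprB -natrB 1?ltnW //; congr (- _%:R); lia.
Qed.

Lemma rval_qnat a d : (0 < d)%N -> rval (qnat a d) = a%:R / d%:R.
Proof. by move=> d0; rewrite rval_qfrac // subr0. Qed.

Lemma rval0 : rval 0 = 0.
Proof. by rewrite rvalE subrr mul0r. Qed.

Let qE := (rvalE, natrD, natrM).

Lemma rval_qadd x y : rval (qadd x y) = rval x + rval y.
Proof.
rewrite rval_qfrac ?muln_gt0 // !qE.
by have := qden_gt0 x; have := qden_gt0 y; move=> /lt0r_neq0 ? /lt0r_neq0 ?; field; apply/andP.
Qed.

Lemma rval_qsub x y : rval (qsub x y) = rval x - rval y.
Proof.
rewrite rval_qfrac ?muln_gt0 // !qE.
by have := qden_gt0 x; have := qden_gt0 y; move=> /lt0r_neq0 ? /lt0r_neq0 ?; field; apply/andP.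
Qed.

Lemma rval_qmul x y : rval (qmul x y) = rval x * rval y.
Proof.
rewrite rval_qfrac ?muln_gt0 // !qE.
by have := qden_gt0 x; have := qden_gt0 y; move=> /lt0r_neq0 ? /lt0r_neq0 ?; field; apply/andP.
Qed.

Lemma qpos_qneg m : qpos m = 0%N \/ qneg m = 0%N.
Proof. by rewrite /qpos /qneg; case: ifP; [left|right]. Qed.

Lemma rval_qinv x : 0 < rval x -> rval (qinv x) = (rval x)^-1.
Proof.
rewrite rvalE pmulr_lgt0 ?invr_gt0 ?qden_gt0 // subr_gt0 ltr_nat => lt_x.
have qx : qneg x = 0%N by case: (qpos_qneg x) lt_x => // ->.
by rewrite rval_qfrac ?(leq_ltn_trans _ lt_x) // qx subr0 subr0 invf_div.
Qed.

Lemma qleE x y : qle x y = (rval x <= rval y).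
Proof.
rewrite !rvalE ler_pdivrMr ?qden_gt0 // mulrAC ler_pdivlMr ?qden_gt0 //.
rewrite -subr_ge0 /qle -(ler_nat R) -[in LHS]subr_ge0 !natrD !natrM.
by congr (0 <= _); ring.
Qed.

Lemma node_vmap2 f k a b i : (i < k)%N ->
  node (vmap2 f k a b) i = f (node a i) (node b i).
Proof.
elim: k a b i => // k IHk a b [|i] ik; first by rewrite node0.
by rewrite nodeS IHk // !node_snd.
Qed.

Lemma node_vscale k c a i : (i < k)%N -> node (vscale k c a) i = qmul c (node a i).
Proof.
elim: k a i => // k IHk a [|i] ik; first by rewrite node0.
by rewrite nodeS IHk // !node_snd.
Qed.

Lemma rval_vdot k a b :
  rval (vdot k a b) = \sum_(i < k) rval (node a i) * rval (node b i).
Proof.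
elim: k a b => [|k IHk] a b; first by rewrite big_ord0 rval0.
rewrite /= big_ord_recl rval_qadd rval_qmul IHk; congr (_ + _).
by apply: eq_bigr => i _; rewrite !node_snd.
Qed.

Variable n : nat.

Definition vval (m : nat) : 'rV[R]_n := vec_of_rat R (vec_of_nat n m).

Lemma vvalE m i j : vval m i j = rval (node m j).
Proof. by rewrite !mxE. Qed.

Lemma vval_add a b : vval (vmap2 qadd n a b) = vval a + vval b.
Proof.
by apply/rowP => i; rewrite vvalE node_vmap2 // rval_qadd -(vvalE a 0) -(vvalE b 0) !mxE.
Qed.

Lemma vval_sub a b : vval (vmap2 qsub n a b) = vval a - vval b.
Proof.
by apply/rowP => i; rewrite vvalE node_vmap2 // rval_qsub -(vvalE a 0) -(vvalE b 0) !mxE.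
Qed.

Lemma vval_scale c a : vval (vscale n c a) = rval c *: vval a.
Proof. by apply/rowP => i; rewrite vvalE node_vscale // rval_qmul -(vvalE a 0) !mxE. Qed.

Lemma rval_dot a b : rval (vdot n a b) = dot (vval a) (vval b).
Proof. by rewrite rval_vdot; apply: eq_bigr => i _; rewrite !vvalE. Qed.

Lemma vval_reflect w x : vval w != 0 -> vval (vreflect n w x) = reflection (vval w) (vval x).
Proof.
move=> w0; rewrite vval_sub vval_scale !(rval_qmul, rval_dot) rval_qnat //
  rval_qinv ?rval_dot ?divr1 //.
by rewrite lt0r dot_eq0 w0 dot_ge0.
Qed.

Fixpoint place k (m : nat) (x : 'rV[R]_n) : 'rV[R]_n :=
  if k is k'.+1 then place k' (snd_nat m) (reflection (vval (fst_nat m)) x)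
  else x + vval (fst_nat m).

Lemma mirrorsP k m : mirrors n k m = [forall i : 'I_k, vval (node m i) != 0].
Proof.
elim: k m => [|k IHk] m /=; first by apply/esym/forallP => -[].
rewrite IHk qleE rval0 rval_dot -ltNge lt0r dot_eq0 dot_ge0 andbT.
apply/andP/forallP => [[m0 /forallP mS] i|h].
  by case: (unliftP ord0 i) => [j ->|->] //; have := mS j; rewrite node_snd.
by split; [exact: (h ord0)|apply/forallP => i; have := h (lift ord0 i); rewrite node_snd].
Qed.

Lemma vval_place k m x : mirrors n k m -> vval (vplace n k m x) = place k m (vval x).
Proof.
elim: k m x => [|k IHk] m x /=; first by rewrite vval_add.
move=> /andP[m0 mS].
by rewrite IHk // vval_reflect // -dot_eq0 gt_eqF // -rval_dot ltNge -rval0 -qleE.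
Qed.

End CodeValues.

(** * Rational placements *)

Lemma pow2E s : pow2 s = (2 ^ s)%N.
Proof. by elim: s => //= s; rewrite /pow2 /= => ->; rewrite addnn -mul2n expnS. Qed.

Lemma pow2_gt0 s : (0 < pow2 s)%N.
Proof. by rewrite pow2E expn_gt0. Qed.

Lemma mesh_gt0 s : (0 < mesh s)%N.
Proof. by rewrite muln_gt0 pow2_gt0. Qed.

Lemma grid_gt0 s : (0 < grid s)%N.
Proof. by rewrite muln_gt0 mesh_gt0. Qed.

Lemma stream_code (P : nat -> nat -> Prop) k b :
  (forall i, (i < k)%N -> exists2 c, (c <= b)%N & P i c) ->
  exists2 m, (m <= stream_bound k b)%N & forall i, (i < k)%N -> P i (node m i).
Proof.
elim: k P => [|k IHk] P exP; first by exists 0%N.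
have [|m m_le mP] := IHk (fun i => P i.+1); first by move=> i ik; exact: exP.
have [c c_le cP] := exP 0%N isT.
exists (pair_nat c m); first exact: leq_pair_nat.
by case=> [_|i ik]; rewrite ?node0 // nodeS; exact: mP.
Qed.

Section Placements.
Variables (R : realType) (n : nat).
Implicit Types (x y w v : 'rV[R]_n) (sigma : 'rV[R]_n -> 'rV[R]_n) (ws : seq 'rV[R]_n).

Lemma round_coord s (a : R) : `|a| <= (pow2 s)%:R ->
  exists2 c, (c <= coord_bound s)%N & `|rval R c - a| <= (grid s)%:R^-1.
Proof.
move=> a_le; have G0 : 0 < (grid s)%:R :> R by rewrite ltr0n grid_gt0.
pose z := Num.floor (a * (grid s)%:R).
have z_bound : (`|z| <= pow2 s * grid s)%N.
  have : `|a * (grid s)%:R| <= (pow2 s * grid s)%:R.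
    by rewrite normrM (ger0_norm (ltW G0)) natrM ler_pM2r.
  rewrite ler_norml => /andP[lo hi].
  have z_le : z <= (pow2 s * grid s)%N.
    by rewrite -(ler_int R); apply: le_trans hi; exact: floor_le.
  have z_ge : - (pow2 s * grid s)%N%:Z <= z by rewrite floor_ge_int rmorphN.
  by move: z_le z_ge; move: (_ * _)%N => K; lia.
exists (qfrac (if 0 <= z then `|z|%N else 0) (if 0 <= z then 0 else `|z|%N) (grid s)).
  rewrite /coord_bound /qfrac; apply: leq_pair_nat; last exact: leq_pred.
  move: z_bound; move: (_ * _)%N => K; move: (`|z|%N) => b; case: (0 <= z).
    by rewrite leq0n; lia.
  by case: b => [|b]; rewrite ?ltn0 /=; lia.
rewrite rval_qfrac ?grid_gt0 //.
have -> : (if 0 <= z then `|z|%N else 0%N)%:R - (if 0 <= z then 0%N else `|z|%N)%:R = z%:~R :> R.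
  have [z0|z0] := leP 0 z; rewrite ?subr0 ?sub0r pmulrn.
    by congr _%:~R; lia.
  by rewrite -mulrNz; congr _%:~R; lia.
have := floor_le (a * (grid s)%:R); have := floorD1_gt (a * (grid s)%:R).
rewrite -/z intrD => hi lo.
have -> : z%:~R / (grid s)%:R - a = (z%:~R - a * (grid s)%:R) / (grid s)%:R.
  by rewrite mulrBl mulfK ?gt_eqF.
rewrite normrM [X in _ * X]ger0_norm ?invr_ge0 ?(ltW G0) // ler_piMl ?invr_ge0 ?(ltW G0) //.
by rewrite ler_norml; apply/andP; split; lra.
Qed.

Lemma round_vec s x : enorm x <= (pow2 s)%:R ->
  exists2 c, (c <= vec_bound n s)%N & enorm (vval R n c - x) <= n%:R / (grid s)%:R.
Proof.
move=> x_le; have [|c c_le cP] := @stream_code (fun i c => forall j : 'I_n, j = i :> nat ->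
    `|rval R c - x 0 j| <= (grid s)%:R^-1) n (coord_bound s).
  move=> i i_lt; have [|c c_le cP] := @round_coord s (x 0 (Ordinal i_lt)).
    exact: le_trans (enorm_coord _ _) x_le.
  by exists c => // j ji; rewrite (_ : j = Ordinal i_lt) //; exact: val_inj.
exists c => //; apply: enorm_le_coord => [|i]; first by rewrite invr_ge0.
have -> : (vval R n c - x) 0 i = rval R (node c i) - x 0 i.
  by rewrite -(vvalE R c 0 i) !mxE.
exact: cP.
Qed.

Lemma enorm_mirrors ws x : enorm (foldl (fun y w => reflection w y) x ws) = enorm x.
Proof. by elim: ws x => //= w ws IHws x; rewrite IHws enorm_reflection. Qed.

Lemma placeE k m x : place k m x =
  foldl (fun y w => reflection w y) x (mkseq (fun i => vval R n (node m i)) k) +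
  vval R n (node m k).
Proof.
elim: k m x => //= k IHk m x; rewrite IHk node_snd; congr (foldl _ _ _ + _).
rewrite /mkseq (iotaDl 1 0 k) -map_comp.
by apply: eq_map => i; rewrite /= node_snd add1n.
Qed.

Lemma enorm_placeB k m x y : enorm (place k m x - place k m y) = enorm (x - y).
Proof.
rewrite !placeE opprD addrACA subrr addr0 -!mul_mirrors_mx -mulmxBl mul_mirrors_mx.
exact: enorm_mirrors.
Qed.

Lemma place_isom k m : mirrors n k m -> ~~ odd k -> isom_plus (place k m : 'rV[R]_n -> _).
Proof.
rewrite (mirrorsP R) => /forallP m0 odd_k; split=> [x y|]; first exact: enorm_placeB.
exists (mirrors_mx (mkseq (fun i => vval R n (node m i)) k)), (vval R n (node m k)).
split=> [|x]; last by rewrite placeE mul_mirrors_mx.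
rewrite det_mirrors_mx; first by rewrite size_mkseq -signr_odd (negPf odd_k).
by apply/allP => w /mapP[i]; rewrite mem_iota => ik ->; exact: (m0 (Ordinal ik)).
Qed.

(** Normalizing [w'] gives a unit vector [u] within [2 * e] of [w] and the same reflection. The
    difference of the reflections splits into two terms, each of size at most [4 * e * enorm x]. *)
Lemma reflection_close w w' x (e : R) : dot w w = 1 -> e <= 2^-1 -> enorm (w' - w) <= e ->
  w' != 0 /\ enorm (reflection w' x - reflection w x) <= 8 * e * enorm x.
Proof.
move=> w1 e_le w'w; have ew1 : enorm w = 1 by rewrite enormE w1 sqrtr1.
have e0 : 0 <= e by exact: le_trans (enorm_ge0 _) w'w.
have w'_gt : 0 < enorm w'.
  have := enorm_lerB w w'; rewrite ew1 enormB => h; apply: lt_le_trans (_ : 2^-1 <= _).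
    by rewrite invr_gt0.
  by lra.
split; first by rewrite -enorm_gt0.
pose u := (enorm w')^-1 *: w'.
have u1 : enorm u = 1 by rewrite enormZ ger0_norm ?invr_ge0 ?enorm_ge0 // mulVf ?gt_eqF.
have uu1 : dot u u = 1 by rewrite -enorm_sq u1 expr1n.
have wu : enorm (w - u) <= 2 * e.
  have -> : w - u = (w - w') + (enorm w' - 1) *: u.
    rewrite scalerBl scale1r scalerA divff ?gt_eqF // scale1r addrA; congr (_ - _).
    by rewrite subrK.
  apply: le_trans (enorm_triangle _ _) _; rewrite enormZ u1 mulr1 enormB.
  have := enorm_lerB w w'; have := enorm_lerB w' w; rewrite ew1 (enormB w w') => h1 h2.
  have : `|enorm w' - 1| <= e by rewrite ler_norml; apply/andP; split; lra.
  by lra.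
have -> : reflection w' x = reflection u x by rewrite reflectionZ // invr_eq0 gt_eqF.
have -> : reflection u x - reflection w x = (2 * dot x (w - u)) *: w + (2 * dot x u) *: (w - u).
  rewrite /reflection w1 uu1 !divr1; apply/rowP => i; rewrite !mxE !dotE; ring.
apply: le_trans (enorm_triangle _ _) _; rewrite !enormZ ew1 mulr1 !normrM ger0_norm //.
have := cauchy_schwarz x u; have := cauchy_schwarz x (w - u); rewrite u1 mulr1 => h1 h2.
have h3 : enorm x * enorm (w - u) <= enorm x * (2 * e) by rewrite ler_wpM2l ?enorm_ge0.
have h4 : `|dot x u| * enorm (w - u) <= enorm x * (2 * e).
  by rewrite ler_pM ?enorm_ge0.
by rewrite -!mulrA; lra.
Qed.

(** Each reflection is an exact isometry, so the errors of the single mirrors add up without being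
    amplified. *)
Lemma place_close k m ws v (e : R) x : size ws = k -> all (fun w => dot w w == 1) ws ->
  e <= 2^-1 -> (forall i, (i < k)%N -> enorm (vval R n (node m i) - nth 0 ws i) <= e) ->
  enorm (vval R n (node m k) - v) <= e ->
  enorm (place k m x - (foldl (fun y w => reflection w y) x ws + v)) <=
    k%:R * (8 * e * enorm x) + e.
Proof.
move=> + + e_le; elim: k m x ws => [|k IHk] m x [|w ws] //= sz ws1 close close_v.
  by rewrite opprD addrACA subrr add0r mul0r add0r; exact: close_v.
have [w1 ws1'] := andP ws1; have [sz'] := sz.
have [_ close0] := @reflection_close w (vval R n (fst_nat m)) x e (eqP w1) e_le (close 0%N isT).
apply: le_trans (enorm_distD (place k (snd_nat m) (reflection w x)) _ _) _.
rewrite enorm_placeB -natr1 mulrDl mul1r [X in X + e]addrC -[leRHS]addrA lerD //.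
have := IHk (snd_nat m) (reflection w x) ws sz' ws1'; rewrite enorm_reflection; apply.
  by move=> i ik; rewrite node_snd; exact: (close i.+1).
by rewrite node_snd.
Qed.

Lemma isom_plus_mirrors sigma : (0 < n)%N -> isom_plus sigma ->
  exists ws v, [/\ size ws = (n + n)%N, all (fun w => dot w w == 1) ws &
    forall x, sigma x = foldl (fun y w => reflection w y) x ws + v].
Proof.
move=> n0 [iso [M [v [dM sE]]]].
have normM x : dot (x *m M) (x *m M) = dot x x.
  have := iso x 0; rewrite !sE mul0mx add0r addrK subr0 => h.
  by rewrite -!enorm_sq h.
have oM : orthogonal_mx M.
  move=> x y; have := normM (x + y); rewrite mulmxDl !dotE !normM !(dotC y) !(dotC (y *m M)).
  by lra.
have [ws [sz ws1 Mws]] := orthogonal_mirrors n0 oM dM.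
by exists ws, v; split=> // x; rewrite sE Mws mul_mirrors_mx.
Qed.

(** The translation part is [sigma 0], as mirrors fix the origin; it must lie in the range of the
    codes. The bound [n + n <= grid s] brings the rounding error of a mirror below [1 / 2], so that
    rounded mirrors remain nonzero. *)
Lemma place_dense s sigma : (0 < n)%N -> isom_plus sigma ->
  enorm (sigma 0) <= (pow2 s)%:R -> (n + n <= grid s)%N ->
  exists m, [/\ (m <= place_bound n s)%N, mirrors n (n + n) m & forall x,
    enorm (place (n + n) m x - sigma x) <=
      (n + n)%:R * (8 * (n%:R / (grid s)%:R) * enorm x) + n%:R / (grid s)%:R].
Proof.
move=> n0 iso sigma0 nG; have [ws [v [sz ws1 sE]]] := isom_plus_mirrors n0 iso.
have v_le : enorm v <= (pow2 s)%:R.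
  move: sigma0; rewrite sE -mul_mirrors_mx mul0mx add0r //.
pose a i := if (i < n + n)%N then nth 0 ws i else v.
have a_le i : enorm (a i) <= (pow2 s)%:R.
  rewrite /a; case: ltnP => // ik; have := allP ws1 (nth 0 ws i).
  rewrite mem_nth ?sz // => /(_ isT)/eqP w1.
  by rewrite enormE w1 sqrtr1 ler1n pow2_gt0.
have [|m m_le mP] := @stream_code
    (fun i c => enorm (vval R n c - a i) <= n%:R / (grid s)%:R) (n + n).+1 (vec_bound n s).
  by move=> i _; exact: round_vec.
have e_le : n%:R / (grid s)%:R <= 2^-1 :> R.
  rewrite ler_pdivrMr ?ltr0n ?grid_gt0 // mulrC ler_pdivlMr // -natrM ler_nat.
  by rewrite muln2 -addnn.
have close i : (i < n + n)%N -> enorm (vval R n (node m i) - nth 0 ws i) <= n%:R / (grid s)%:R.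
  by move=> ik; have := mP i (ltnW ik); rewrite /a ik.
have close_v : enorm (vval R n (node m (n + n)) - v) <= n%:R / (grid s)%:R.
  by have := mP (n + n)%N (leqnn _); rewrite /a ltnn.
exists m; split=> // [|x]; last by rewrite sE; exact: place_close.
rewrite (mirrorsP R); apply/forallP => i; have ik := ltn_ord i.
have := allP ws1 (nth 0 ws i); rewrite mem_nth ?sz // => /(_ isT)/eqP w1.
by have [] := @reflection_close _ _ 0 _ w1 e_le (close i ik).
Qed.

End Placements.

(** * One stage of the search *)

Section Stage.
Variables (R : realType) (n : nat).
Implicit Types (f g : R -> 'rV[R]_n) (s p q : nat).

Notation T s := ((pow2 s)%:R : R).
Notation N s := ((mesh s)%:R : R).
Notation G s := ((grid s)%:R : R).
Notation pt p i := (vval R n (node p i)).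

Lemma pow2R_gt0 s : 0 < T s. Proof. by rewrite ltr0n pow2_gt0. Qed.
Lemma meshR_gt0 s : 0 < N s. Proof. by rewrite ltr0n mesh_gt0. Qed.
Lemma gridR_gt0 s : 0 < G s. Proof. by rewrite ltr0n grid_gt0. Qed.

Lemma pow2_large (c : R) : \forall s \near \oo, c <= T s.
Proof.
exists (Num.truncn `|c|).+1 => // s /= cs; apply: le_trans (ler_norm c) _.
have /andP[_ /ltW h] := truncn_itv (normr_ge0 c); apply: le_trans h _.
by rewrite ler_nat (leq_trans cs) // pow2E ltnW // ltn_expl.
Qed.

Lemma div_mesh s (c : R) : c <= T s -> c / N s <= (T s)^-1.
Proof.
move=> cT; have T0 := pow2R_gt0 s.
by rewrite ler_pdivrMr ?meshR_gt0 // natrM mulKf ?gt_eqF.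
Qed.

Lemma div_grid s (c : R) : 0 <= c -> c <= T s -> c / G s <= (T s)^-1.
Proof.
move=> c0 cT; apply: le_trans (div_mesh cT); rewrite ler_wpM2l //.
rewrite lef_pV2 ?posrE ?gridR_gt0 ?meshR_gt0 //.
by rewrite ler_nat leq_pmulr ?mesh_gt0.
Qed.

Lemma basedP p : based n p = (pt p 0 == 0).
Proof. by rewrite /based (qleE R) rval_dot rval0 -dot_eq0 eq_le dot_ge0 andbT. Qed.

Lemma rval_sqn a b : rval R (sqn n a b) = enorm (vval R n a - vval R n b) ^+ 2.
Proof. by rewrite /sqn rval_dot vval_sub enorm_sq. Qed.

Lemma speed_leP s p a : reflect
  (forall i, (i < mesh s)%N -> enorm (pt p i.+1 - pt p i) <= a%:R / T s / N s)
  (speed_le n s p a).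
Proof.
have T0 := pow2R_gt0 s; have N0 := meshR_gt0 s.
have stepE i : qle (sqn n (node p i.+1) (node p i)) (qnat (a * a) (grid s * mesh s)) =
    (enorm (pt p i.+1 - pt p i) <= a%:R / T s / N s).
  have d0 : (0 < grid s * mesh s)%N by rewrite muln_gt0 grid_gt0 mesh_gt0.
  rewrite (qleE R) rval_sqn (rval_qnat _ _ d0).
  rewrite -[in RHS]ler_sqr ?nnegrE ?enorm_ge0 ?divr_ge0 //; congr (_ <= _).
  have -> : (grid s * mesh s)%:R = (T s * N s) ^+ 2 :> R.
    by rewrite -natrM -natrX; congr _%:R; rewrite /grid /mesh; ring.
  by rewrite -mulrA -invfM expr_div_n natrM.
apply: (iffP allP) => [h i iN|h i]; first by rewrite -stepE; apply: h; rewrite mem_iota.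
by rewrite mem_iota /= add0n stepE; exact: h.
Qed.

Definition polygon_of s p f :=
  (forall l : R, (forall i, (i < mesh s)%N -> enorm (pt p i.+1 - pt p i) <= l / N s) ->
     paths l f) /\
  forall i, (i <= mesh s)%N -> f (i%:R / N s) = pt p i.

Lemma polygon_exists s p : exists f, polygon_of s p f.
Proof. by have [f fl fp] := uniform_polygon (fun i => pt p i) (mesh_gt0 s); exists f. Qed.

Lemma polygon_paths s p a f : polygon_of s p f -> speed_le n s p a -> paths (a%:R / T s) f.
Proof. by move=> [fl _] /speed_leP h; apply: fl. Qed.

Lemma polygon_based s p f : polygon_of s p f -> based n p -> f 0 = 0.
Proof. by move=> [_ fp]; rewrite basedP => /eqP <-; rewrite -fp // mul0r. Qed.

Lemma vval0 : vval R n 0 = 0.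
Proof.
have node00 i : node 0 i = 0%N.
  by rewrite /node; elim: i => // i; rewrite iterSr; apply.
by apply/rowP => i; rewrite vvalE node00 rval0 mxE.
Qed.

Lemma path_code s f (l : R) : paths l f -> f 0 = 0 -> l <= T s -> exists p,
  [/\ (p <= path_bound n s)%N, based n p &
      forall i, (i <= mesh s)%N -> enorm (pt p i - f (i%:R / N s)) <= n%:R / G s].
Proof.
move=> fl f0 lT; have l0 := paths_ge0 fl.
have [|p p_le pP] := @stream_code
    (fun i c => enorm (vval R n c - f (i%:R / N s)) <= n%:R / G s /\ (i = 0%N -> vval R n c = 0))
    (mesh s).+1 (vec_bound n s).
  (* [based] demands an exact zero, so the first vertex is not rounded. *)
  move=> [|i] iN; first by exists 0%N; rewrite ?vval0 // mul0r f0 subrr enorm0 divr_ge0.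
  have [|c c_le cP] := @round_vec R n s (f (i.+1%:R / N s)); last by exists c.
  have := paths_near0 l0 fl (node01 R (mesh_gt0 s) (iN : (i.+1 <= mesh s)%N)).
  rewrite f0 subr0 => h.
  exact: le_trans h lT.
exists p; split=> // [|i iN]; last by have [] := pP i iN.
by rewrite basedP; have [_ ->] := pP 0%N isT.
Qed.

Lemma path_code_speed s f (l : R) p a : paths l f ->
  (forall i, (i <= mesh s)%N -> enorm (pt p i - f (i%:R / N s)) <= n%:R / G s) ->
  2 * n%:R <= T s -> l + (T s)^-1 <= a%:R / T s -> speed_le n s p a.
Proof.
move=> fl pf nT la; apply/speed_leP => i iN; have N0 := meshR_gt0 s.
have h1 := pf i (ltnW iN); have h2 := pf i.+1 iN.
have h3 := fl _ _ (node01 R (mesh_gt0 s) iN) (node01 R (mesh_gt0 s) (ltnW iN)).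
have e1 : `|i.+1%:R / N s - i%:R / N s| = (N s)^-1.
  by rewrite -mulrBl -natrB // subSnn mul1r ger0_norm // invr_ge0 ltW.
rewrite e1 in h3.
have := enorm_distD (f (i.+1%:R / N s)) (pt p i.+1) (pt p i).
have := enorm_distD (f (i%:R / N s)) (f (i.+1%:R / N s)) (pt p i).
rewrite (enormB (f (i%:R / N s)) (pt p i)).
have h4 : 2 * (n%:R / G s) <= (T s)^-1 / N s.
  rewrite (natrM _ (mesh s)) invfM !mulrA ler_pM2r ?invr_gt0 //.
  exact: div_mesh.
have h5 : (l + (T s)^-1) / N s <= a%:R / T s / N s by rewrite ler_pM2r ?invr_gt0.
by rewrite mulrDl in h5; move: h1 h2 h3 h4 h5; lra.
Qed.

Section Oracle.
Variables (B : set 'rV[R]_n) (phi : 'rV[rat]_n -> nat -> rat).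
Hypotheses (n_gt0 : (0 < n)%N) (phi_name : sdist_name B phi) (tB : tame B).
Let o := oracle_of phi.

Lemma oracle_near x s : `|rval R (o (pair_nat x s)) - sdist B (vval R n x)| <= (T s)^-1.
Proof.
rewrite /o /oracle_of fst_pair_nat snd_pair_nat /rval rat_of_natK.
by have := phi_name (vec_of_nat n x) s; rewrite pow2E natrX exprVn.
Qed.

(** A coded placement is itself an isometry, so a failed test exhibits a true placement and only the
    error of the oracle is lost. *)
Lemma not_hits s th p : ~~ hits n o s th p -> exists2 sigma, isom_plus sigma &
  forall i, (i <= mesh s)%N -> sdist B (sigma (pt p i)) <= rval R th + (T s)^-1.
Proof.
case/allPn => m _; rewrite negb_imply => /andP[mm /hasPn h]; exists (place (n + n) m).
  by apply: place_isom => //; rewrite addnn odd_double.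
move=> i iN; have := h i; rewrite mem_iota => /(_ iN).
rewrite (qleE R) -ltNge -vval_place // => lt_th.
have := oracle_near (vplace n (n + n) m (node p i)) s.
by rewrite ler_norml => /andP[]; lra.
Qed.

Definition net_error s (C : R) := (n + n)%:R * (8 * (n%:R / G s) * C) + n%:R / G s.

Lemma hits_placement s th p sigma (C : R) : hits n o s th p -> isom_plus sigma ->
  (n + n <= grid s)%N -> enorm (sigma 0) <= T s ->
  (forall i, (i <= mesh s)%N -> enorm (pt p i) <= C) ->
  exists2 i, (i <= mesh s)%N &
    rval R th - (T s)^-1 - net_error s C <= sdist B (sigma (pt p i)).
Proof.
move=> hp iso nG s0 pC; have [m [m_le mm mE]] := place_dense n_gt0 iso s0 nG.
have mI : m \in iota 0 (place_bound n s).+1 by rewrite mem_iota add0n ltnS.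
have /hasP[i] := implyP (allP hp m mI) mm.
rewrite mem_iota add0n ltnS (qleE R) => iN th_le; exists i => //.
have := oracle_near (vplace n (n + n) m (node p i)) s; rewrite vval_place // ler_norml => /andP[_].
have := tB.1 (place (n + n) m (pt p i)) (sigma (pt p i)).
have := mE (pt p i).
have : (n + n)%:R * (8 * (n%:R / G s) * enorm (pt p i)) + n%:R / G s <= net_error s C.
  by rewrite lerD2r ler_wpM2l // ler_wpM2l ?pC // mulr_ge0 ?divr_ge0.
by move: th_le; lra.
Qed.

Lemma net_error_small (C : R) : 0 <= C -> \forall s \near \oo, net_error s C <= (T s)^-1.
Proof.
move=> C0; have := pow2_large ((n + n)%:R * (8 * n%:R * C) + n%:R); apply: filterS => s cT.
have -> : net_error s C = ((n + n)%:R * (8 * n%:R * C) + n%:R) / G s.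
  by rewrite /net_error; ring.
by apply: div_grid => //; rewrite addr_ge0 ?mulr_ge0.
Qed.

End Oracle.

End Stage.

(** * Convergence *)

Section Convergence.
Variables (R : realType) (n : nat) (B : set 'rV[R]_n) (L : R) (phi : 'rV[rat]_n -> nat -> rat).
Hypotheses (n_gt0 : (0 < n)%N) (sharpB : sharp B L) (phi_name : sdist_name B phi).
Implicit Types (f g : R -> 'rV[R]_n) (s p q h j : nat).

Let o := oracle_of phi.
Let tB : tame B. Proof. by have [] := sharpB. Qed.
Let L0 : 0 < L. Proof. by have [] := sharpB. Qed.

Notation T s := ((pow2 s)%:R : R).
Notation N s := ((mesh s)%:R : R).
Notation G s := ((grid s)%:R : R).
Notation pt p i := (vval R n (node p i)).

Lemma rval_threshold_pos s : rval R (qnat 3 (pow2 s)) = 3 * (T s)^-1.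
Proof. by rewrite rval_qnat ?pow2_gt0. Qed.

Lemma rval_threshold_neg s : rval R (qfrac 0 3 (pow2 s)) = - (3 * (T s)^-1).
Proof. by rewrite rval_qfrac ?pow2_gt0 // sub0r mulNr. Qed.

Lemma grid_large (k : nat) : \forall s \near \oo, (k <= grid s)%N.
Proof.
apply: filterS (pow2_large (k%:R : R)) => s; rewrite ler_nat => /leq_trans; apply.
by rewrite /grid /mesh -!mulnA leq_pmulr // !muln_gt0 pow2_gt0.
Qed.

(** Half of [2 ^ - s] pays for going to the nearest node, the other half for the rounding of the
    vertex. *)
Lemma fits_of_nodes (l c : R) f s p sigma : paths l f -> isom_plus sigma ->
  2 * l <= T s -> 2 * n%:R <= T s ->
  (forall i, (i <= mesh s)%N -> enorm (pt p i - f (i%:R / N s)) <= n%:R / G s) ->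
  (forall i, (i <= mesh s)%N -> sdist B (sigma (pt p i)) <= c) ->
  fits B (c + (T s)^-1) f.
Proof.
move=> fl iso lT nT pf pc; exists sigma => // t t01.
have [i iN /andP[ti0 tiN]] := nearest_node (mesh_gt0 s) t01.
have := fl t _ t01 (node01 R (mesh_gt0 s) iN); rewrite ger0_norm // => h1.
have l0 := paths_ge0 fl.
have h2 : l * (t - i%:R / N s) <= l / N s by rewrite ler_wpM2l.
have h3 := div_mesh lT; have h4 := div_grid (mulr_ge0 (ler0n R 2) (ler0n R n)) nT.
rewrite -mulrA in h3; rewrite -mulrA in h4.
have := tB.1 (sigma (f t)) (sigma (pt p i)); rewrite iso.1.
have := enorm_distD (f (i%:R / N s)) (f t) (pt p i).
rewrite (enormB (f (i%:R / N s)) (pt p i)); have := pf i iN; have := pc i iN.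
move: h1 h2 h3 h4; lra.
Qed.

Lemma hits_of_escapes (l c : R) f s p th : paths l f -> escapes B c f ->
  2 * l <= T s -> 2 * n%:R <= T s ->
  (forall i, (i <= mesh s)%N -> enorm (pt p i - f (i%:R / N s)) <= n%:R / G s) ->
  rval R th + 2 * (T s)^-1 < c -> hits n o s th p.
Proof.
move=> fl ef lT nT pf thc; apply: contraT => /(not_hits phi_name)[sigma iso sp].
exfalso; apply: fits_escapes ef; last exact: fits_of_nodes fl iso lT nT pf sp.
by lra.
Qed.

(** At a speed below [L] the polygon would fit with a margin, but [hits] leaves at least one unit
    [2 ^ - s] of the threshold after the oracle and the net each take one. The margin depends on [a]
    and [s], so only its sign is used. *)
Lemma escapable_speed : \forall s \near \oo, forall a, escapable n o s a -> L <= a%:R / T s.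
Proof.
have [_ [K dK]] := tB; have [_ _ fit _] := sharpB.
near=> s => a /hasP[g _ /and3P[g0 ga gh]]; rewrite leNgt; apply/negP => aL.
have [f fP] := polygon_exists R n s g; have fl := polygon_paths fP ga.
have f0 := polygon_based fP g0.
have [e e0 /(_ f fl)[sigma iso sf]] := fit _ (paths_ge0 fl) aL.
have h01 : 0 <= (0 : R) <= 1 by rewrite lexx ler01.
have [||i iN|i iN] := hits_placement n_gt0 phi_name tB (C := L) gh iso.
- by near: s; exact: grid_large.
- have := sf 0 h01; rewrite f0 => s0; have := dK (sigma 0) => s1.
  have : K <= T s by near: s; exact: pow2_large.
  by lra.
- rewrite -fP.2 //; have := paths_near0 (paths_ge0 fl) fl (node01 R (mesh_gt0 s) iN).
  by rewrite f0 subr0 => /le_trans; apply; exact: ltW.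
have := sf _ (node01 R (mesh_gt0 s) iN); rewrite fP.2 // rval_threshold_pos.
have : net_error n s L <= (T s)^-1 by near: s; apply: net_error_small; exact: ltW.
have : 0 < (T s)^-1 by rewrite invr_gt0 pow2R_gt0.
by lra.
Unshelve. all: by end_near. Qed.

Lemma candidate_complete f : solution B L f -> \forall s \near \oo, exists p,
  [/\ (p <= path_bound n s)%N, candidate n o s p &
      forall i, (i <= mesh s)%N -> enorm (pt p i - f (i%:R / N s)) <= n%:R / G s].
Proof.
move=> [fL f0 ef]; near=> s.
have LT : 2 * L <= T s by near: s; exact: pow2_large.
have nT : 2 * n%:R <= T s by near: s; exact: pow2_large.
have T0 : 0 < (T s)^-1 by rewrite invr_gt0 pow2R_gt0.
have LT' : L <= T s by have := L0; lra.
have [p [p_le p0 pf]] := path_code fL f0 LT'.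
exists p; split=> //; apply/and3P; split=> //.
  (* The threshold plus the losses is [- 3 + 2 = - 1] units of [2 ^ - s]; half a unit leaves the
     inequality strict. *)
  have e0 : 0 < 2^-1 * (T s)^-1 by lra.
  apply: (hits_of_escapes fL (ef _ e0) LT nT pf).
  by rewrite rval_threshold_neg; lra.
apply/allP => a _; apply/implyP => ea.
apply: (path_code_speed fL pf nT); rewrite -natr1 mulrDl mul1r lerD2r.
by move: a ea; near: s; exact: escapable_speed.
Unshelve. all: by end_near. Qed.

Lemma candidate_speed (l : R) : L < l -> \forall s \near \oo, forall p, candidate n o s p ->
  exists2 a, speed_le n s p a & a%:R / T s <= l.
Proof.
move=> Ll; have [l' Ll' l'l] := ex_mid Ll; have [_ _ _ exc] := sharpB.
have [g [c c0 [gl eg]]] := exc l' Ll'.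
pose f t := g t - g 0.
have fl : paths l' f by move=> s t s01 t01; rewrite /f opprB addrA subrK; exact: gl.
have f0 : f 0 = 0 by rewrite /f subrr.
have ef : escapes B c f by exact: escapes_translate.
have l'0 := paths_ge0 fl.
near=> s => p /and3P[_ _ /allP pa].
have lT : 2 * l' <= T s by near: s; exact: pow2_large.
have nT : 2 * n%:R <= T s by near: s; exact: pow2_large.
have T0 : 0 < T s by exact: pow2R_gt0.
have Ti0 : 0 < (T s)^-1 by rewrite invr_gt0.
have cT : 6 / c <= T s by near: s; exact: pow2_large.
have lT3 : 3 / (l - l') <= T s by near: s; exact: pow2_large.
have T4 : 4 <= T s by near: s; exact: pow2_large.
have cTi : 6 * (T s)^-1 <= c.
  by move: cT; rewrite ler_pdivrMr // mulrC => ?; rewrite ler_pdivrMr // mulrC.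
have lTi : 3 * (T s)^-1 <= l - l'.
  by move: lT3; rewrite ler_pdivrMr ?subr_gt0 // mulrC => ?; rewrite ler_pdivrMr // mulrC.
(* One unit makes up for the truncation and one for rounding the vertices. A candidate may be one
   unit faster still, which accounts for the [3] in [lT3]. *)
pose a := (Num.truncn (l' * T s)).+2.
have /andP[a_lo a_hi] := truncn_itv (mulr_ge0 l'0 (ltW T0)).
have aE : a%:R = (Num.truncn (l' * T s))%:R + 2 :> R by rewrite /a -addn2 natrD.
rewrite -natr1 in a_hi.
have lT' : l' <= T s by lra.
have [q [q_le q0 qf]] := path_code fl f0 lT'.
have a_mesh : (a <= mesh s)%N.
  rewrite -(ler_nat R) aE natrM; apply: (@le_trans _ _ (l' * T s + 2)); first by lra.
  have : l' * T s <= T s / 2 * T s by rewrite ler_pM2r //; lra.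
  have : 4 * T s <= T s * T s by rewrite ler_pM2r.
  by lra.
exists a.+1; last first.
  rewrite ler_pdivrMr // -natr1 aE.
  have : 3 <= (l - l') * T s by move: lT3; rewrite ler_pdivrMr ?subr_gt0 // mulrC.
  by rewrite mulrBl; lra.
have := pa a; rewrite mem_iota ltnS a_mesh => /(_ isT)/implyP; apply.
apply/hasP; exists q; first by rewrite mem_iota ltnS.
rewrite q0 /=; apply/andP; split.
  apply: (path_code_speed fl qf nT); rewrite ler_pdivlMr // mulrDl mulVf ?gt_eqF // aE.
  by lra.
apply: (hits_of_escapes fl ef lT nT qf); rewrite rval_threshold_pos; lra.
Unshelve. all: by end_near. Qed.

(** A placement that sends the origin beyond [2 ^ s] is not covered by the net, but escapes at time
    zero by coercivity. For the others the threshold, the oracle and the net cost [3 + 1 + 1 = 5]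
    units of [2 ^ - s]. *)
Lemma candidate_escapes (C e : R) : 0 <= C -> 0 < e -> \forall s \near \oo, forall p f,
  candidate n o s p -> polygon_of s p f -> paths C f -> escapes B (- e) f.
Proof.
move=> C0 e0; have [_ [K dK]] := tB; near=> s => p f /and3P[p0 ph _] fP fC sigma iso.
have f0 := polygon_based fP p0.
have h01 : 0 <= (0 : R) <= 1 by rewrite lexx ler01.
have [s0|s0] := leP (enorm (sigma 0)) (T s); last first.
  exists 0 => //; rewrite f0; have := dK (sigma 0).
  have : K <= T s by near: s; exact: pow2_large.
  by lra.
have [||i iN] := hits_placement n_gt0 phi_name tB (C := C) ph iso _ s0.
- by near: s; exact: grid_large.
- move=> i iN; rewrite -fP.2 //; have := paths_near0 C0 fC (node01 R (mesh_gt0 s) iN).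
  by rewrite f0 subr0.
rewrite rval_threshold_neg => si; exists (i%:R / N s); first exact: node01 (mesh_gt0 s) iN.
rewrite fP.2 //; have : net_error n s C <= (T s)^-1 by near: s; exact: net_error_small.
have : 5 * (T s)^-1 <= e.
  rewrite ler_pdivrMr ?pow2R_gt0 // mulrC -ler_pdivrMr //; near: s; exact: pow2_large.
by move: si; lra.
Unshelve. all: by end_near. Qed.

(* The entry [j] of a name is the code [<t, k>] of its index. *)
Definition meets f q j := 0 <= rval R (fst_nat j) <= 1 ->
  enorm (f (rval R (fst_nat j)) - vval R n q) <= 2^-1 ^+ snd_nat j.

Definition meets_all f j h := forall i, (i < j)%N -> meets f (node h i) (j - i.+1).

Lemma near_guard j :
  qle 0 (fst_nat j) && qle (fst_nat j) (qnat 1 1) = (0 <= rval R (fst_nat j) <= 1).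
Proof. by rewrite !(qleE R) rval0 rval_qnat // divr1. Qed.

Lemma near_indexE s t i : near_index s t i = (`|i%:R - rval R t * N s| <= 1).
Proof.
rewrite /near_index !(qleE R) !rval_qsub rval_qmul !rval_qnat // !divr1 ler_norml.
by rewrite andbC lerNl opprB.
Qed.

Lemma close_sqE s p q k i : qle (sqn n (node p i) q) (close_sq s k) =
  (enorm (pt p i - vval R n q) <= 2^-1 ^+ k + (T s)^-1).
Proof.
have e0 : 0 <= (pow2 k)%:R^-1 + (T s)^-1 by rewrite addr_ge0 ?invr_ge0.
rewrite (qleE R) rval_sqn rval_qmul rval_qadd !rval_qnat ?pow2_gt0 // !mul1r -expr2.
by rewrite ler_sqr ?nnegrE ?enorm_ge0 ?e0 // [pow2 k]pow2E natrX exprVn.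
Qed.

(** The slack [2 ^ - s] in [close_sq] is spent half on the rounding of the vertex and half on the
    distance in time to it. *)
Lemma consistent_complete f j h : solution B L f -> meets_all f j h ->
  \forall s \near \oo, consistent n o s j h.
Proof.
move=> fS fm; have [fL _ _] := fS.
near=> s; have [p [p_le pc pf]] : exists p,
  [/\ (p <= path_bound n s)%N, candidate n o s p &
      forall i, (i <= mesh s)%N -> enorm (pt p i - f (i%:R / N s)) <= n%:R / G s].
  by near: s; exact: candidate_complete.
have LT : 2 * L <= T s by near: s; exact: pow2_large.
have nT : 2 * n%:R <= T s by near: s; exact: pow2_large.
have h3 := div_mesh LT; have h4 := div_grid (mulr_ge0 (ler0n R 2) (ler0n R n)) nT.
rewrite -mulrA in h3; rewrite -mulrA in h4; have N0 := meshR_gt0 R s.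
apply/hasP; exists p; first by rewrite mem_iota ltnS.
rewrite pc; apply/allP => i; rewrite mem_iota => /andP[_ ij].
apply/implyP; rewrite near_guard => t01; apply/allP => m; rewrite mem_iota ltnS => /andP[_ mN].
apply/implyP; rewrite near_indexE close_sqE => mt.
have := fm i ij t01; set t := rval R _ in t01 mt *; set k := snd_nat _ => fq.
have := fL _ _ (node01 R (mesh_gt0 s) mN) t01 => h1.
have h2 : `|m%:R / N s - t| <= (N s)^-1.
  have -> : m%:R / N s - t = (m%:R - t * N s) / N s by rewrite mulrBl mulfK ?gt_eqF.
  by rewrite normrM [X in _ * X]ger0_norm ?invr_ge0 ?(ltW N0) // ler_piMl ?invr_ge0 // ltW.
have h5 : L * `|m%:R / N s - t| <= L / N s by rewrite ler_wpM2l // ltW.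
have := pf m mN; have := enorm_distD (f (m%:R / N s)) (pt p m) (vval R n (node h i)).
have := enorm_distD (f t) (f (m%:R / N s)) (vval R n (node h i)).
by move: fq h1 h3 h4 h5; lra.
Unshelve. all: by end_near. Qed.

(** The polygons that pass have eventually speed at most [L + 1], hence cluster; the bounds on
    speed, escape and entries tighten with the stage and hold exactly in the limit. *)
Lemma consistent_sound j h : (forall s0, exists2 s, (s0 <= s)%N & consistent n o s j h) ->
  exists2 f, solution B L f & meets_all f j h.
Proof.
move=> io; have L1 : L < L + 1 by rewrite ltrDl.
have [S0 _ S0P] := candidate_speed L1.
have ex k : exists sp : nat * nat, exists f : R -> 'rV[R]_n,
  [/\ (k <= sp.1)%N /\ (S0 <= sp.1)%N, candidate n o sp.1 sp.2,
      polygon_of sp.1 sp.2 f, paths (L + 1) f &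
      forall i, (i < j)%N -> near n sp.1 sp.2 (node h i) (j - i.+1)].
  have [s s_ge /hasP[p _ /andP[pc pn]]] := io (maxn k S0).
  have [f fP] := polygon_exists R n s p; exists (s, p), f.
  have [ks Ss] : (k <= s /\ S0 <= s)%N by split; rewrite (leq_trans _ s_ge) ?leq_maxl ?leq_maxr.
  split=> //= [|i ij]; last by apply: (allP pn); rewrite mem_iota.
  have [a pa aL] := S0P s Ss p pc; exact: le_paths aL (polygon_paths fP pa).
have [sp spP] := choice ex; have [f_ f_P] := choice spP.
have C0 : 0 <= L + 1 by exact: ltW (lt_trans L0 L1).
have [k|k|f [fC f0 near_f]] := @paths_cluster R n (L + 1) f_ C0.
- by have [] := f_P k.
- have [_ /and3P[p0 _ _] fP _ _] := f_P k; exact: polygon_based fP p0.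
exists f.
  apply: (limit_solution tB _ _ near_f f0) => [l Ll|e e0].
    have [k0 _ k0P] := candidate_speed Ll; exists k0 => k k0k.
    have [[ks _] pc fP _ _] := f_P k.
    have [a pa al] := k0P _ (leq_trans k0k ks) _ pc.
    exact: le_paths al (polygon_paths fP pa).
  have [k0 _ k0P] := candidate_escapes C0 e0; exists k0 => k k0k.
  have [[ks _] pc fP fl _] := f_P k.
  exact: k0P _ (leq_trans k0k ks) _ _ pc fP fl.
move=> i ij; rewrite /meets; set t := rval R _; set m := snd_nat _ => t01.
apply/ler_addgt0Pr => e e0.
have [k0 _ k0P] := pow2_large (3 * (L + 1) / e + 3 / e).
have e3 : 0 < e / 3 by rewrite divr_gt0.
have [k k0k kf] := near_f (e / 3) e3 k0.
have [[ks _] pc fP fl /(_ i ij)] := f_P k.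
set s := (sp k).1 in ks pc fP *; set p := (sp k).2 in pc fP *.
have Ts := k0P _ (leq_trans k0k ks) : 3 * (L + 1) / e + 3 / e <= T s.
rewrite /near near_guard t01 => /allP pn.
have [u uN /andP[ut0 utN]] := nearest_node (mesh_gt0 s) t01.
have := pn u; rewrite mem_iota ltnS uN => /(_ isT); rewrite near_indexE close_sqE.
have N0 := meshR_gt0 R s; have T0 := pow2R_gt0 R s.
have -> : `|u%:R - t * N s| <= 1.
  have -> : u%:R - t * N s = - ((t - u%:R / N s) * N s) by rewrite mulrBl divfK ?gt_eqF // opprB.
  rewrite normrN ger0_norm; last by rewrite mulr_ge0 // ltW.
  by rewrite -ler_pdivlMr // div1r.
rewrite implyTb => hq.
have h1 := fl t _ t01 (node01 R (mesh_gt0 s) uN); rewrite fP.2 // ger0_norm // in h1.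
have h2 : (L + 1) * (t - u%:R / N s) <= (L + 1) / N s by rewrite ler_wpM2l.
have h3 : 3 * ((L + 1) / N s) <= e.
  rewrite mulrA ler_pdivrMr // [leRHS]mulrC -ler_pdivrMr //; apply: le_trans (_ : T s <= _).
    by apply: le_trans Ts; rewrite lerDl divr_ge0 // ltW.
  by rewrite ler_nat leq_pmulr ?pow2_gt0.
have h4 : 3 * (T s)^-1 <= e.
  rewrite ler_pdivrMr // mulrC -ler_pdivrMr //.
  by apply: le_trans Ts; rewrite lerDr divr_ge0 ?mulr_ge0 // ltW.
have := kf t t01; have := enorm_distD (f_ k t) (f t) (vval R n (node h i)).
have := enorm_distD (pt p u) (f_ k t) (vval R n (node h i)).
rewrite (enormB (f t) (f_ k t)); move: hq h1 h2 h3 h4; lra.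
Qed.

End Convergence.

(** * Stabilization of the guesses *)

Section Limit.
Variables (R : realType) (n : nat) (B : set 'rV[R]_n) (L : R) (phi : 'rV[rat]_n -> nat -> rat).
Hypotheses (n_gt0 : (0 < n)%N) (sharpB : sharp B L) (phi_name : sdist_name B phi).
Implicit Types (f g : R -> 'rV[R]_n) (s p q h j : nat).

Let o := oracle_of phi.

Lemma meets_exists f j : exists q, meets f q j.
Proof.
have [t01|nt] := pselect (0 <= rval R (fst_nat j) <= 1); last by exists 0%N.
set x := f (rval R (fst_nat j)).
have near_s : \forall s \near \oo,
    enorm x <= (pow2 s)%:R /\ n%:R / (grid s)%:R <= 2^-1 ^+ snd_nat j :> R.
  near=> s; split; first by near: s; exact: pow2_large.
  apply: le_trans (div_grid (ler0n R n) _) _; first by near: s; exact: pow2_large.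
  rewrite exprVn lef_pV2 ?posrE ?exprn_gt0 ?pow2R_gt0 //; near: s; exact: pow2_large.
have [s [xs ns]] := filter_ex near_s.
have [q _ qx] := round_vec xs; exists q => _.
by rewrite enormB; exact: le_trans qx ns.
Unshelve. all: by end_near. Qed.

Lemma meets_all_pair f j q h :
  meets_all f j.+1 (pair_nat q h) <-> meets f q j /\ meets_all f j h.
Proof.
split=> [fm|[fq fh] [_|i ij]]; last 2 first.
- by rewrite node0 subn1.
- by rewrite nodeS subSS; exact: fh.
split=> [|i ij]; first by have := fm 0%N isT; rewrite node0 subn1.
by have := fm i.+1 ij; rewrite nodeS subSS.
Qed.

Definition settled j h := (exists2 f, solution B L f & meets_all f j h) /\
  \forall s \near \oo, history n o s j = h.

Lemma settled0 : settled 0 0.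
Proof.
split; first by have [f fS] := solution_exists sharpB; exists f.
by near=> s.
Unshelve. all: by end_near. Qed.

(** The new entry is the least code that some solution compatible with [h] admits. Each smaller code
    is rejected at all large stages, by the contrapositive of soundness, and there are finitely many
    of them; the code itself is accepted by completeness. *)
Lemma settledS j h : settled j h -> exists v, settled j.+1 (pair_nat v h).
Proof.
move=> [[f0 f0S f0h] hist].
pose good v := `[< exists2 f, solution B L f & meets_all f j.+1 (pair_nat v h) >].
have ex_good : exists v, good v.
  have [q f0q] := meets_exists f0 j; exists q; apply/asboolP; exists f0 => //.
  exact/meets_all_pair.
have [v /asboolP v_good v_min] := ex_minnP ex_good; exists v; split=> //.
have [f fS fv] := v_good.
have bad : \forall s \near \oo, forall u, (u < v)%N -> ~~ consistent n o s j.+1 (pair_nat u h).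
  have bad1 u : (u < v)%N -> \forall s \near \oo, ~~ consistent n o s j.+1 (pair_nat u h).
    move=> uv; apply: contrapT => nev.
    have /v_min : good u; last by rewrite leqNgt uv.
    apply/asboolP; apply: (consistent_sound n_gt0 sharpB phi_name) => s0.
    apply: contrapT => nex; apply: nev; exists s0 => // s /= s0s.
    by apply/negP => su; apply: nex; exists s.
  suff bad_lt m : (m <= v)%N -> \forall s \near \oo,
      forall u, (u < m)%N -> ~~ consistent n o s j.+1 (pair_nat u h) by exact: bad_lt.
  elim: m => [_|m IHm mv]; first by exists 0%N => // s _ u; rewrite ltn0.
  near=> s => u; rewrite ltnS leq_eqVlt => /predU1P[->|].
    by near: s; exact: bad1.
  by move: u; near: s; exact: IHm (ltnW mv).
near=> s; rewrite /history /= -/(history n o s j).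
have -> : history n o s j = h by near: s; exact: hist.
congr pair_nat.
have vs : (v < s)%N by near: s; exists v.+1.
have v_ok : consistent n o s j.+1 (pair_nat v h).
  by near: s; apply: (consistent_complete n_gt0 sharpB phi_name fS fv).
have u_bad : forall u, (u < v)%N -> ~~ consistent n o s j.+1 (pair_nat u h).
  by near: s; exact: bad.
set P := fun u => consistent n o s j.+1 (pair_nat u h).
have hasP' : has P (iota 0 s) by apply/hasP; exists v; rewrite ?mem_iota.
have find_lt : (find P (iota 0 s) < s)%N by rewrite -[X in (_ < X)%N](size_iota 0) -has_find.
apply/eqP; rewrite eqn_leq; apply/andP; split; rewrite leqNgt; apply/negP => lt.
  by have := before_find 0%N lt; rewrite nth_iota // add0n /P v_ok.
by have := nth_find 0%N hasP'; rewrite nth_iota // add0n; apply/negP; exact: u_bad.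
Unshelve. all: by end_near. Qed.

Lemma settled_sequence : exists v H : nat -> nat,
  (forall j, H j.+1 = pair_nat (v j) (H j)) /\ forall j, settled j (H j).
Proof.
have step (x : {jh : nat * nat | settled jh.1 jh.2}) :
    exists v, settled (sval x).1.+1 (pair_nat v (sval x).2).
  by have /settledS := svalP x.
have [v vP] := choice step.
pose next x : {jh : nat * nat | settled jh.1 jh.2} :=
  exist _ ((sval x).1.+1, pair_nat (v x) (sval x).2) (vP x).
pose x j := iter j next (exist (fun jh : nat * nat => settled jh.1 jh.2) (0%N, 0%N) settled0).
have x1 j : (sval (x j)).1 = j by elim: j => //= j ->.
exists (fun j => v (x j)), (fun j => (sval (x j)).2); split=> // j.
by have := svalP (x j); rewrite x1.
Qed.

(** The solutions compatible with longer and longer lists may differ, but a cluster point of them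
    meets every entry, since each entry is a closed condition that almost all of them satisfy. *)
Lemma limit_path : exists f, exists v : nat -> nat, [/\ solution B L f,
  forall j, meets f (v j) j & forall j, \forall s \near \oo, guess_of n o (pair_nat j s) = v j].
Proof.
have [v [H [HS setH]]] := settled_sequence.
have ex j : exists f, solution B L f /\ meets_all f j (H j).
  by have [[f fS fm] _] := setH j; exists f.
have [f_ f_P] := choice ex.
have meets_f i j : (i < j)%N -> meets (f_ j) (v i) i.
  have [_] := f_P j; move: (f_ j) => f; elim: j => // j IHj.
  rewrite HS => /meets_all_pair[fj fH]; rewrite ltnS leq_eqVlt.
  case/predU1P=> [->//|ij]; exact: IHj fH ij.
have [tB L0 _ _] := sharpB.
have [j|j|f [fL f0 near_f]] := @paths_cluster R n L f_ (ltW L0).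
- by have [[]] := f_P j.
- by have [[]] := f_P j.
exists f, v; split=> [|j t01|j].
- apply: (limit_solution tB _ _ near_f f0) => [l Ll|e e0].
    by exists 0%N => k _; have [[fk _ _] _] := f_P k; exact: le_paths (ltW Ll) fk.
  by exists 0%N => k _; have [[_ _ fk] _] := f_P k; exact: fk.
- apply/ler_addgt0Pr => e e0; have [k jk kf] := near_f e e0 j.+1.
  have := meets_f j k jk t01; have := kf _ t01.
  have := enorm_distD (f_ k (rval R (fst_nat j))) (f (rval R (fst_nat j))) (vval R n (v j)).
  rewrite (enormB (f _) (f_ k _)); lra.
have [_] := setH j.+1; apply: filterS => s; rewrite /guess_of (fst_pair_nat j s) snd_pair_nat.
by move=> ->; rewrite HS fst_pair_nat.
Qed.

End Limit.

Theorem theorem4p3 (R : realType) (n : nat) (n_gt0 : (0 < n)%N) :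
  exists c : program, forall A : set 'rV[R]_n, forest A ->
    countable [set r : R | min_esc A < r /\ ~ limit_solves c (sublevel A r)].
Proof.
have [c cP] := computable_guess_of n; exists c => A fA.
apply: (@sub_countable _ _ _ [set: rat]); last exact: countableP.
apply: card_le_trans (card_image_le (fun q : rat => esc A (ratr q)) _).
apply: subset_card_le => r [Ar nsolves]; apply: contrapT => r_esc; apply: nsolves => phi phi_name.
have sharpB : sharp (sublevel A r) (L1 (sublevel A r)).
  by apply: sublevel_sharp => // q; apply/eqP => qr; apply: r_esc; exists q.
have [f [v [fS fv guessP]]] := limit_path n_gt0 sharpB phi_name.
pose entry t k := pair_nat (nat_of_rat t) k.
have entry1 t k : rval R (fst_nat (entry t k)) = ratr t.
  by rewrite /entry fst_pair_nat /rval rat_of_natK.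
exists f, (fun t k => vec_of_nat n (v (entry t k))); split.
- exact: solution_forest.
- move=> t k t01; have := fv (entry t k); rewrite /meets entry1 snd_pair_nat enormB; apply.
  by case/andP: t01 => t0 t1; rewrite ler0q t0 -(ler_rat R) rmorph1 in t1 *.
move=> t k _; exists (fun s => guess_of n (oracle_of phi) (pair_nat (entry t k) s)).
split=> [s|]; first exact: cP.
have [s0 _ s0P] := guessP (entry t k); exists s0 => s s0s.
by rewrite s0P.
Qed.
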